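(* Let $\mathcal V,\mathcal W\subset\mathcal H$ be finite dimensional subspaces with $\mathcal V\oplus\mathcal W^\perp=\mathcal H$, $d=\dim\mathcal V=\dim\mathcal W$, and let $\{w_j\}_{j\in\mathbb I_d}$ be an orthonormal basis of $\mathcal W$ of principal vectors between $\mathcal V$ and $\mathcal W$. Let $\mathcal F=\{f_i\}_{i\in\mathbb I_n}$ be a frame for $\mathcal W$ with $\lambda(S_{\mathcal F})=(\lambda_i)_{i\in\mathbb M}$, and assume $n\ge 2d$. Let $\{x_j\}_{j\in\mathbb I_d}$ be an orthonormal basis of $\mathcal W$ such that $S_{\mathcal F}x_j=\lambda_jx_j$ for every $j\in\mathbb I_d$, and let $U_0\in B(\mathcal H)$ be a unitary operator such that $U_0x_j=w_{d-j+1}$ for every $j\in\mathbb I_d$. Let $U\in B(\mathcal H)$ be a unitary operator such that $U(\mathcal W)=\mathcal W$. Then: 1. $\operatorname{tr}(S_{(U_0\cdot\mathcal F)^\#_{\mathcal V}})\le\operatorname{tr}(S_{(U\cdot\mathcal F)^\#_{\mathcal V}})$. 2. If $t\ge\operatorname{tr}(S_{(U\cdot\mathcal F)^\#_{\mathcal V}})$, and $\mathcal G^{\rm op}_t(U)\in\mathcal D_{\mathcal V,t}(U\cdot\mathcal F)$ and $\mathcal G^{\rm op}_t(U_0)\in\mathcal D_{\mathcal V,t}(U_0\cdot\mathcal F)$ are optimal duals, then for every $h\in\mathrm{Conv}(\mathbb R_{\ge0})$ $$P_h(\mathcal G^{\rm op}_t(U_0))\le P_h(\mathcal G^{\rm 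op}_t(U)).$$
   Context: $\mathcal H$ is a complex separable Hilbert space; $\mathbb I_k=\{1,\dots,k\}$; $\mathbb M=\mathbb I_p$ if $\dim\mathcal H=p<\infty$ and $\mathbb M=\mathbb N$ if $\dim\mathcal H=\infty$. $\mathcal V\oplus\mathcal W^\perp=\mathcal H$ means $\mathcal V+\mathcal W^\perp=\mathcal H$ and $\mathcal V\cap\mathcal W^\perp=\{0\}$. $P_{\mathcal V}$ is the orthogonal projection onto $\mathcal V$, $P_{\mathcal V//\mathcal W^\perp}$ is the oblique projection with range $\mathcal V$ and null space $\mathcal W^\perp$, and $|T|=(T^*T)^{1/2}$. Principal angles: $0\le\theta_1\le\dots\le\theta_d\le\pi/2$ are such that the $d$ largest singular values of $P_{\mathcal W}P_{\mathcal V}$, in non-increasing order, are $\cos\theta_1,\dots,\cos\theta_d$; here $\theta_d<\pi/2$. An orthonormal basis $\{w_j\}_{j\in\mathbb I_d}$ of $\mathcal W$ consists of principal vectors between $\mathcal V$ and $\mathcal W$ if $|P_{\mathcal V}P_{\mathcal W}|w_j=\cos(\theta_j)w_j$ for every $j\in\mathbb I_d$. For a finite sequence $\mathcal F=\{f_i\}_{i\in\mathbb I_n}$ in $\mathcal H$, $T_{\mathcal F}(a)=\sum_i a_if_i$, $S_{\mathcal F}=T_{\mathcal F}T_{\mathcal F}^*$ is the frame operator, and $U\cdot\mathcal F=\{Uf_i\}_{i\in\mathbb I_n}$. A finite sequence in $\mathcal W$ is a frame for $\mathcal W$ iff it spans $\mathcal W$. For a frame $\mathcal F$ for $\mathcal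 W$, $\mathcal D_{\mathcal V}(\mathcal F)$ is the set of sequences $\mathcal G=\{g_i\}_{i\in\mathbb I_n}$ in $\mathcal V$ with $T_{\mathcal G}T_{\mathcal F}^*=P_{\mathcal V//\mathcal W^\perp}$ (oblique $\mathcal V$-duals), the canonical $\mathcal V$-dual is $\mathcal F^\#_{\mathcal V}=\{P_{\mathcal V//\mathcal W^\perp}S_{\mathcal F}^\dagger f_i\}_{i\in\mathbb I_n}$ ($\dagger$ = Moore-Penrose pseudo-inverse), and $\mathcal D_{\mathcal V,t}(\mathcal F)=\{\mathcal G\in\mathcal D_{\mathcal V}(\mathcal F):\sum_i\|g_i\|^2\ge t\}$. For a finite sequence $\mathcal G$, $\lambda(S_{\mathcal G})=(\lambda_i(S_{\mathcal G}))_{i\in\mathbb M}$ is the list of positive eigenvalues of $S_{\mathcal G}$ (with multiplicity, non-increasing) followed by zeros. $\mathrm{Conv}(\mathbb R_{\ge0})$ is the set of convex functions $h:[0,\infty)\to[0,\infty)$. For such $h$ and a finite sequence $\mathcal G$ whose span has dimension $r$, $P_h(\mathcal G)=\sum_{i=1}^rh(\lambda_i(S_{\mathcal G}))$. Optimal duals (case $n\ge 2d$): for a unitary $U$ with $U(\mathcal W)=\mathcal W$ and $t\ge\operatorname{tr}(S_{(U\cdot\mathcal F)^\#_{\mathcal V}})$, put $\rho_i=\lambda_i(S_{(U\cdot\mathcal F)^\#_{\mathcal V}})$ for $i\in\mathbb I_d$, and let $c\ge\rho_d$ be the unique number with $\sum_{i=1}^d(c-\rho_i)^+=t-\sum_{i=1}^d\rho_i$,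 where $x^+=\max\{x,0\}$. An optimal dual $\mathcal G^{\rm op}_t(U)$ is an element of $\mathcal D_{\mathcal V,t}(U\cdot\mathcal F)$ whose frame operator has eigenvalue list $\big(\rho_1+(c-\rho_1)^+,\dots,\rho_d+(c-\rho_d)^+,0_{|\mathbb M|-d}\big)$; such elements exist and they are exactly the simultaneous minimizers of $P_h$ over $\mathcal D_{\mathcal V,t}(U\cdot\mathcal F)$ for all non-decreasing $h\in\mathrm{Conv}(\mathbb R_{\ge0})$. *)

(* Defs.v *)
From HB Require Import structures.
From mathcomp Require Import all_boot all_order all_algebra complex.
From mathcomp Require Import all_classical all_reals all_analysis.
Set Implicit Arguments.
Unset Strict Implicit.
Unset Printing Implicit Defensive.
Import Order.TTheory GRing.Theory Num.Theory Num.Def numFieldNormedType.Exports.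
Local Open Scope classical_set_scope.
Local Open Scope complex_scope.
Local Open Scope ring_scope.

(* Real numbers are compared with complex ones through %:C; on R[i], x <= y
   means that y - x is real and nonnegative. *)

Section LinearAlgebra.
Context {R : realType} {H : lmodType R[i]}.

(* The synthesis operator of e; its range is the span of e and its injectivity
   is the linear independence of e. *)
Definition synthesis n (e : 'I_n -> H) (a : 'rV[R[i]]_n) : H :=
  \sum_i a 0 i *: e i.

Definition lspan n (e : 'I_n -> H) : set H := range (synthesis e).

Definition has_dim (V : set H) (n : nat) : Prop :=
  exists e : 'I_n -> H, injective (synthesis e) /\ lspan e = V.

Definition dimv (V : set H) : nat := xget 0%N [set n | has_dim V n].

Definition direct_sum_full (V N : set H) : Prop :=
  (forall x, exists v n, [/\ V v, N n & x = v + n]) /\ V `&` N = [set 0].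

(* The projection with range V and null space N, when V (+) N is the whole
   space. *)
Definition oblique_proj (V N : set H) (x : H) : H :=
  xget 0 [set v | V v /\ N (x - v)].

(* The positive eigenvalues of S, repeated according to multiplicity, in
   non-increasing order; only meaningful for positive S of finite rank. *)
Definition pos_eigenvalues (S : H -> H) : seq R :=
  xget [::] [set s : seq R | [/\ sorted >=%R s, {in s, forall m, 0 < m} &
    forall m : R, 0 < m ->
      has_dim [set x | S x = m%:C *: x] (count_mem m s)]].

(* Numbered from 0 and continued by zeros for all indices, also beyond the
   dimension of H. *)
Definition lam (S : H -> H) (i : nat) : R := nth 0 (pos_eigenvalues S) i.

End LinearAlgebra.

(* The adjoint of T : U -> V with respect to the inner products dU and dV; it
   is unique when it exists. *)
Definition adjoint {R : realType} {U V : lmodType R[i]}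
    (dU : U -> U -> R[i]) (dV : V -> V -> R[i]) (T : U -> V) : V -> U :=
  xget (fun=> 0) [set S : V -> U | forall x y, dV (T x) y = dU x (S y)].

Section Hilbert.
Context {R : realType} {H : completeNormedModType R[i]}.
Variable dot : {dot H for conjC}.
Implicit Types (V W : set H) (T S : H -> H).

Definition norm_of_dot : Prop := forall x : H, `|x| ^+ 2 = dot x x.

Definition separable_space : Prop := exists A : set H, countable A /\ dense A.

Definition orthonormal_family n (e : 'I_n -> H) : Prop :=
  forall i j, dot (e i) (e j) = (i == j)%:R.

Definition orthonormal_basis V n (e : 'I_n -> H) : Prop :=
  orthonormal_family e /\ lspan e = V.

Definition orthocomp V : set H := [set x | forall v, V v -> dot x v = 0].

Definition orth_proj V : H -> H := oblique_proj V (orthocomp V).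

Definition bounded_op T : Prop := linear T /\ continuous T.

Definition unitary_op T : Prop :=
  [/\ bounded_op T, adjoint dot dot T \o T = id & T \o adjoint dot dot T = id].

Definition positive_op T : Prop :=
  bounded_op T /\ forall x, 0 <= dot (T x) x.

Definition op_sqrt T : H -> H :=
  xget (fun=> 0) [set B : H -> H | positive_op B /\ B \o B = T].

Definition op_abs T : H -> H := op_sqrt (adjoint dot dot T \o T).

Definition pinv T : H -> H :=
  xget (fun=> 0) [set B : H -> H | bounded_op B /\
    [/\ T \o B \o T = T, B \o T \o B = B,
        adjoint dot dot (T \o B) = T \o B &
        adjoint dot dot (B \o T) = B \o T]].

(* The trace of a finite rank operator. Vectors orthogonal to the range of T
   do not contribute to the sum of the [<T e, e>] over an orthonormal basis of
   H, so it suffices to sum over finitely many e_j whose span contains the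
   range. *)
Definition optrace T : R[i] :=
  xget 0 [set c | exists n (e : 'I_n -> H),
    [/\ orthonormal_family e, range T `<=` lspan e &
        c = \sum_i dot (T (e i)) (e i)]].

Definition analysis n (F : 'I_n -> H) : H -> 'rV[R[i]]_n :=
  adjoint (@dotmx _ n) dot (synthesis F).

Definition frame_op n (F : 'I_n -> H) : H -> H := synthesis F \o analysis F.

Definition frame_for W n (F : 'I_n -> H) : Prop := lspan F = W.

(* The canonical oblique V-dual of F, a frame for W. *)
Definition canonical_dual V W n (F : 'I_n -> H) (i : 'I_n) : H :=
  oblique_proj V (orthocomp W) (pinv (frame_op F) (F i)).

Definition oblique_dual V W n (F G : 'I_n -> H) : Prop :=
  (forall i, V (G i)) /\
  synthesis G \o analysis F = oblique_proj V (orthocomp W).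

Definition oblique_dual_ge V W (t : R) n (F G : 'I_n -> H) : Prop :=
  oblique_dual V W F G /\ t%:C <= \sum_i `|G i| ^+ 2.

(* d is the common dimension of V and W; rho (d - 1) is the smallest of the
   rho i for i < d. *)
Definition optimal_dual V W d (t : R) n (F G : 'I_n -> H) : Prop :=
  let rho := lam (frame_op (canonical_dual V W F)) in
  oblique_dual_ge V W t F G /\
  exists c : R, [/\ rho d.-1 <= c,
    \sum_(i < d) Num.max (c - rho i) 0 = t - \sum_(i < d) rho i &
    forall i : nat, lam (frame_op G) i =
      if (i < d)%N then rho i + Num.max (c - rho i) 0 else 0].

Definition convex_potential (h : R -> R) n (G : 'I_n -> H) : R :=
  \sum_(i < dimv (lspan G)) h (lam (frame_op G) i).

Definition principal_angles V W d (theta : 'I_d -> R) : Prop :=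
  [/\ forall j, 0 <= theta j <= pi / 2,
      {homo theta : i j / (i <= j)%N >-> i <= j} &
      forall j : 'I_d,
        cos (theta j) = lam (op_abs (orth_proj W \o orth_proj V)) j].

Definition principal_vectors V W d (theta : 'I_d -> R) (w : 'I_d -> H) : Prop :=
  orthonormal_basis W w /\
  forall j, op_abs (orth_proj V \o orth_proj W) (w j) =
            (cos (theta j))%:C *: w j.

End Hilbert.

Arguments separable_space {R} H.

(* Functions on [0, +oo[ are total functions on R whose values at negative
   numbers are ignored. *)
Definition convex_nonneg {R : realType} (h : R -> R) : Prop :=
  (forall x, 0 <= x -> 0 <= h x) /\
  convex_function (`[0, +oo[%classic : set R) h.

(* Main.v *)
From Pilot Require Import Defs.
From HB Require Import structures.
From mathcomp Require Import all_boot all_order all_algebra complex.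
From mathcomp Require Import all_classical all_reals all_analysis.
From mathcomp Require Import perm ring lra.
Set Implicit Arguments.
Unset Strict Implicit.
Unset Printing Implicit Defensive.
Import Order.TTheory GRing.Theory Num.Theory Num.Def numFieldNormedType.Exports.
Local Open Scope classical_set_scope.
Local Open Scope complex_scope.
Local Open Scope ring_scope.

(* On [W] write [K] for the inverse of [S_(U F)] and let [Q] be the oblique
   projection onto [V] along the orthocomplement of [W]. The canonical dual has
   frame operator [Q K Q^*], and [Q] sends the principal vectors [w_j] to
   [v_j / cos theta_j] with [v_j] orthonormal, so in the bases [w] and [v] this
   operator is [X = D K D] with [D = diag(1 / cos theta_j)].

   For [tau > 0] put [N = D^-1 max(X, tau) D^-1]. Since [N >= K] and
   [N >= tau D^-2], Weyl monotonicity bounds each ordered eigenvalue of [N] below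
   by those of both matrices, and taking determinants gives
     [prod_i max(rho0_i, tau) <= prod_i max(rho_i, tau)],
   where [rho] is the spectrum of [X] and [rho0] the one obtained from [U0], that
   is the products of oppositely ordered eigenvalues of [K] and [D^2]. Hence
   [rho0] is log-submajorized by [rho]. Summation by parts turns this into the
   trace inequality, and, with the subgradients of [h] at the water-filled
   values as weights, into the inequality of convex potentials; [h] need not be
   monotone because both water-filled spectra have sum [t]. *)

(** * Majorization *)

Section Majorization.
Context {R : realType}.
Implicit Types (a b q u : nat -> R) (h : R -> R).

(** Summation by parts as an induction: the partial sums of [u] are nonnegative, so lowering their
    factor from [q n] to [q n.+1] only decreases the left side. Keeping the last weight as a factor
    lets [q] take any sign. *)
Lemma abel_ge q u n :
    (forall i, (i < n)%N -> q i.+1 <= q i) ->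
    (forall k, (k <= n)%N -> 0 <= \sum_(i < k) u i) ->
  q n * \sum_(i < n.+1) u i <= \sum_(i < n.+1) q i * u i.
Proof.
elim: n => [|n IHn] q_noninc u_ge0; first by rewrite !big_ord1.
rewrite big_ord_recr /= [leRHS]big_ord_recr /= mulrDr lerD2r.
apply: le_trans (IHn _ _) => [|i ilt|k kle].
- by apply: ler_wpM2r; [exact: u_ge0|exact: q_noninc].
- by apply: q_noninc; apply: ltnW.
- by apply: u_ge0; apply: leqW.
Qed.

Lemma abel_ge0 q u d :
    (forall i, (i < d)%N -> 0 <= q i) ->
    (forall i, (i.+1 < d)%N -> q i.+1 <= q i) ->
    (forall k, (k <= d)%N -> 0 <= \sum_(i < k) u i) ->
  0 <= \sum_(i < d) q i * u i.
Proof.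
case: d => [|n] q_ge0 q_noninc u_ge0; first by rewrite big_ord0.
apply: le_trans (abel_ge q_noninc _); last by move=> k kle; apply/u_ge0/leqW.
by apply: mulr_ge0; [apply: q_ge0 | apply: u_ge0].
Qed.

Definition log_submajorized d a b :=
  forall k, (k <= d)%N -> \prod_(i < k) a i <= \prod_(i < k) b i.

(** Take [tau = b k]. As [b] is non-increasing, the right product is that of the [b i] with [i <= k]
    times a power of [b k]; the left one is at least that of the [a i] with [i <= k] times the same
    power, which cancels. *)
Lemma log_submajorized_max d a b :
    (forall i, (i < d)%N -> 0 < a i) -> (forall i, (i < d)%N -> 0 < b i) ->
    (forall i j, (i <= j < d)%N -> b j <= b i) ->
    (forall tau, 0 < tau ->
      \prod_(i < d) Num.max (a i) tau <= \prod_(i < d) Num.max (b i) tau) ->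
  log_submajorized d a b.
Proof.
move=> a_gt0 b_gt0 b_noninc prod_le [_|k kd]; first by rewrite !big_ord0.
have tau_gt0 := b_gt0 k kd; have := prod_le _ tau_gt0.
rewrite -(subnKC kd) !big_split_ord /=.
rewrite [X in _ <= X * _](eq_bigr (fun i : 'I_k.+1 => b i)); last first.
  by move=> i _; apply/max_idPl/b_noninc; rewrite -ltnS ltn_ord.
rewrite [X in _ <= _ * X](eq_bigr (fun=> b k)); last first.
  move=> i _; apply/max_idPr/b_noninc; rewrite addSn leqW ?leq_addr//=.
  by rewrite -[X in (_ < X)%N](subnKC kd) addSn ltnS ltn_add2l.
move=> le_prod; rewrite -(ler_pM2r (x := \prod_(i < d - k.+1) b k)); last first.
  exact: prodr_gt0.
apply: le_trans le_prod; apply: ler_pM; last 2 first.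
- apply: ler_prod => i _; rewrite le_max lexx ?andbT ltW//.
  by apply: a_gt0; apply: leq_trans kd.
- by apply: ler_prod => i _; rewrite le_max lexx orbT andbT ltW.
- by apply: prodr_ge0 => i _; rewrite ltW// a_gt0// (leq_trans _ kd).
- by apply: prodr_ge0 => i _; rewrite ltW.
Qed.

(* [b - a >= a (ln b - ln a)] turns partial products into partial sums. *)
Lemma log_submajorized_sum_ge0 d a b q :
    (forall i, (i < d)%N -> 0 < a i) -> (forall i, (i < d)%N -> 0 < b i) ->
    (forall i j, (i <= j < d)%N -> a j <= a i) -> log_submajorized d a b ->
    (forall i, (i < d)%N -> 0 <= q i) ->
    (forall i, (i.+1 < d)%N -> q i.+1 <= q i) ->
  0 <= \sum_(i < d) q i * (b i - a i).
Proof.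
move=> a_gt0 b_gt0 a_noninc ab q_ge0 q_noninc.
apply: (@le_trans _ _ (\sum_(i < d) q i * a i * (ln (b i) - ln (a i)))).
  apply: (@abel_ge0 (fun i => q i * a i) (fun i => ln (b i) - ln (a i))).
  - by move=> i id; rewrite mulr_ge0 ?q_ge0// ltW ?a_gt0.
  - move=> i id; have id' := ltnW id.
    apply: ler_pM; rewrite ?q_ge0 ?q_noninc ?(ltW (a_gt0 _ _))//.
    by apply: a_noninc; rewrite leqnSn.
  - move=> k kd; rewrite sumrB subr_ge0.
    have ln_prod (v : nat -> R) : (forall i, (i < d)%N -> 0 < v i) ->
        \sum_(i < k) ln (v i) = ln (\prod_(i < k) v i) /\ 0 < \prod_(i < k) v i.
      move=> v_gt0; elim: k kd => [|k IHk] kd.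
        by rewrite !big_ord0 ln1; split.
      have [IH pos] := IHk (ltnW kd).
      by rewrite !big_ord_recr /= IH lnM ?posrE ?v_gt0// mulr_gt0 ?v_gt0.
    have [-> pa] := ln_prod _ a_gt0; have [-> pb] := ln_prod _ b_gt0.
    by rewrite ler_ln ?posrE// ab.
apply: ler_sum => i _; have [ai bi] := (a_gt0 i (ltn_ord i), b_gt0 i (ltn_ord i)).
rewrite -mulrA ler_wpM2l ?q_ge0//.
have := expR_ge1Dx (ln (b i) - ln (a i)).
rewrite expRB !lnK ?posrE// => H.
have -> : b i - a i = a i * (b i / a i - 1) by field; rewrite gt_eqF.
by rewrite ler_pM2l//; lra.
Qed.

Lemma convex_chord h (x y z : R) : convex_nonneg h -> 0 <= z -> z < y -> y < x ->
  (h y - h z) / (y - z) <= (h x - h y) / (x - y).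
Proof.
move=> [_ h_convex] z_ge0 zy yx.
have xz : 0 < x - z by lra.
have t01 : 0 <= (y - z) / (x - z) <= 1.
  by rewrite divr_ge0 ?ler_pdivrMr//=; lra.
(* The weight [(y - z) / (x - z)] on [x] makes the convex combination equal to [y]. *)
have := h_convex (Itv01 (andP t01).1 (andP t01).2) x z.
rewrite !inE /= !in_itv /= !andbT => /(_ _ _)/=.
have x_ge0 : 0 <= x by lra.
move=> /(_ x_ge0 z_ge0); rewrite !convR_line_path /line_path /=.
set u := conv _ _ _; have -> : u = y.
  rewrite -[LHS]/((y - z) / (x - z) * x + (1 - (y - z) / (x - z)) * z).
  by field; rewrite gt_eqF.
rewrite -(ler_pM2r xz).
have -> : ((1 - (y - z) / (x - z)) * h z + (y - z) / (x - z) * h x) * (x - z)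
   = (x - y) * h z + (y - z) * h x by field; rewrite gt_eqF.
move=> H; rewrite ler_pdivrMr; last lra.
rewrite mulrAC ler_pdivlMr; last lra.
by lra.
Qed.

(** The slope is the supremum of the slopes of the chords to the left of [y], which [convex_chord]
    bounds by every slope to the right. As [y > 0], the chord from [0] makes this set nonempty. *)
Lemma convex_subgradient h (y : R) : convex_nonneg h -> 0 < y ->
  exists m, forall z, 0 <= z -> h y + m * (z - y) <= h z.
Proof.
move=> h_convex y_gt0.
pose A := [set (h y - h z) / (y - z) | z in [set z | 0 <= z < y]].
have A_ub x : y < x -> ubound A ((h x - h y) / (x - y)).
  move=> yx _ [z /= /andP[z0 zy] <-]; exact: convex_chord.
have A0 : A !=set0 by exists ((h y - h 0) / (y - 0)), 0 => //=; rewrite lexx.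
exists (sup A) => z z_ge0; have [zy|yz|<-] := ltgtP z y.
- have Az : A ((h y - h z) / (y - z)) by exists z => //=; rewrite z_ge0.
  have : (h y - h z) / (y - z) <= sup A.
    apply: ub_le_sup Az; exists ((h (y + 1) - h y) / (y + 1 - y)).
    by apply: A_ub; lra.
  by rewrite ler_pdivrMr; lra.
- have := ge_sup A0 (A_ub _ yz).
  by rewrite ler_pdivlMr; lra.
- by rewrite subrr mulr0 addr0.
Qed.

(* On the indices where [c0] is active, the subgradient is the constant one at
   [c0], which can be subtracted from all of them because the sums agree; on the
   others the filled value is [a i]. *)
Lemma convex_water_filling d a b c0 c h : convex_nonneg h ->
    (forall i, (i < d)%N -> 0 < a i) -> (forall i, (i < d)%N -> 0 < b i) ->
    (forall i j, (i <= j < d)%N -> a j <= a i) -> log_submajorized d a b ->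
    a d.-1 <= c0 ->
    \sum_(i < d) (a i + Num.max (c0 - a i) 0) =
      \sum_(i < d) (b i + Num.max (c - b i) 0) ->
  \sum_(i < d) h (a i + Num.max (c0 - a i) 0) <=
    \sum_(i < d) h (b i + Num.max (c - b i) 0).
Proof.
move=> h_convex a_gt0 b_gt0 a_noninc ab a_last sum_eq.
have [d0|d_gt0] := posnP d; first by subst d; rewrite !big_ord0.
have c0_gt0 : 0 < c0 by apply: lt_le_trans a_last; apply: a_gt0; rewrite prednK.
have fillE (x v : R) : v + Num.max (x - v) 0 = Num.max v x.
  by rewrite addr_maxr addr0 addrC subrK maxC.
move: sum_eq; under eq_bigr do rewrite fillE.
under [X in _ = X]eq_bigr do rewrite fillE.
under [in X in _ -> X <= _]eq_bigr do rewrite fillE.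
under [in X in _ -> _ <= X]eq_bigr do rewrite fillE.
move=> sum_eq.
have /choice[m mP] y : exists m, 0 < y -> forall z, 0 <= z ->
    h y + m * (z - y) <= h z.
  have [y_gt0|y_le0] := ltP 0 y; last by exists 0.
  by have [m mP] := convex_subgradient h_convex y_gt0; exists m.
(* Adding the subgradient inequalities at [x] and at [y], each evaluated at the other point, gives
   [(m y - m x) * (y - x) >= 0]. *)
have m_mono (x y : R) : 0 < x -> x <= y -> m x <= m y.
  move=> x0; rewrite le_eqVlt => /predU1P[->//|xy].
  have y0 : 0 < y by lra.
  have := mP x x0 y (ltW y0); have := mP y y0 x (ltW x0); nra.
pose q i := m (Num.max (a i) c0) - m c0.
have qs : 0 <= \sum_(i < d) q i * (b i - a i).
  apply: log_submajorized_sum_ge0 => // i id.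
    by rewrite subr_ge0 m_mono// le_max lexx orbT.
  rewrite lerD2r m_mono ?lt_max ?c0_gt0 ?orbT// ge_max !le_max lexx orbT andbT.
  by rewrite a_noninc// leqnSn.
(* Of the two added sums, the one weighted by [q] is nonnegative by [qs], and the multiple of [m c0]
   vanishes because both filled spectra have the same sum. *)
apply: (@le_trans _ _ (\sum_(i < d) (h (Num.max (a i) c0) + q i * (b i - a i)
    + m c0 * (Num.max (b i) c - Num.max (a i) c0)))).
  rewrite !big_split /= -mulr_sumr sumrB sum_eq subrr mulr0 addr0.
  by rewrite lerDl.
apply: ler_sum => i _; have [ai bi] := (a_gt0 i (ltn_ord i), b_gt0 i (ltn_ord i)).
have b0 : 0 < Num.max (b i) c by rewrite lt_max bi.
have a0 : 0 < Num.max (a i) c0 by rewrite lt_max ai.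
apply: le_trans (mP _ a0 _ (ltW b0)); rewrite -addrA lerD2l /q.
(* Where [c0] is active, [q i = 0] and the two sides coincide. Elsewhere the filled value is [a i],
   [q i >= 0], and filling can only raise [b i]. *)
have [ac|ca] := leP (a i) c0; first by rewrite subrr mul0r add0r.
have : b i <= Num.max (b i) c by rewrite le_max lexx.
have : m c0 <= m (a i) by apply: m_mono => //; apply: ltW.
by nra.
Qed.

End Majorization.

(** * Eigenvalues of hermitian matrices *)

Section Matrices.
Context {R : realType}.
Local Open Scope sesquilinear_scope.
Local Notation C := R[i].

Definition diagR d (f : 'I_d -> R) : 'M[C]_d := diag_mx (\row_k (f k)%:C).

Lemma diagR_herm d (f : 'I_d -> R) : (diagR f)^t* = diagR f.
Proof.
apply/matrixP => i j; rewrite !mxE eq_sym; case: eqVneq => [->|_].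
  by rewrite !mulr1n conj_Creal// complex_real.
by rewrite !mulr0n conjC0.
Qed.

Lemma conj_diag_herm d (z : 'M[C]_d) (f : 'I_d -> R) :
  (z^t* *m diagR f *m z)^t* = z^t* *m diagR f *m z.
Proof. by rewrite !(trmx_mul, map_mxM) /= trmxCK diagR_herm !mulmxA. Qed.

Lemma conj_diagE d (z : 'M[C]_d) (f : 'I_d -> R) i j :
  (z^t* *m diagR f *m z) i j = \sum_k (f k)%:C * ((z k i)^* * z k j).
Proof.
rewrite mxE; apply: eq_bigr => k _; rewrite mul_mx_diag !mxE.
by rewrite mulrAC mulrC.
Qed.

Lemma quad_diag d (b : 'rV[C]_d) (f : 'I_d -> R) :
  (b *m diagR f *m b^t*) 0 0 = \sum_k (f k)%:C * `|b 0 k| ^+ 2.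
Proof.
rewrite mxE; apply: eq_bigr => k _; rewrite mul_mx_diag !mxE.
by rewrite normCK mulrAC mulrC.
Qed.

Lemma quad_conj_diag d (a : 'rV[C]_d) (z : 'M[C]_d) (f : 'I_d -> R) :
  (a *m (z^t* *m diagR f *m z) *m a^t*) 0 0 =
    \sum_k (f k)%:C * `|(a *m z^t*) 0 k| ^+ 2.
Proof.
rewrite -quad_diag; congr (_ 0 0).
by rewrite trmx_mul map_mxM /= trmxCK !mulmxA.
Qed.

Lemma norm_unitary d (a : 'rV[C]_d) (z : 'M[C]_d) : z \is unitarymx ->
  \sum_k `|(a *m z^t*) 0 k| ^+ 2 = \sum_k `|a 0 k| ^+ 2.
Proof.
move=> zU; have sqE (b : 'rV[C]_d) : \sum_k `|b 0 k| ^+ 2 = (b *m b^t*) 0 0.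
  by rewrite mxE; apply: eq_bigr => k _; rewrite !mxE normCK.
by rewrite !sqE trmx_mul map_mxM /= trmxCK mulmxA mulmxKtV.
Qed.

(* Weyl's monotonicity: a vector orthogonal to the last rows of [u] and to the
   first rows of [y] separates the two eigenvalues, and exists by a dimension
   count, here the vanishing of a determinant with a zero column. *)
Lemma eigenvalue_mono d (u y : 'M[C]_d) (kap nu : 'I_d -> R) :
    u \is unitarymx -> y \is unitarymx ->
    {homo kap : i j / (i <= j)%N >-> j <= i} ->
    {homo nu : i j / (i <= j)%N >-> j <= i} ->
    (forall a : 'rV[C]_d, (a *m (u^t* *m diagR kap *m u) *m a^t*) 0 0 <=
       (a *m (y^t* *m diagR nu *m y) *m a^t*) 0 0) ->
  forall i, kap i <= nu i.
Proof.
move=> uU yU kap_noninc nu_noninc le_form i.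
pose M := \matrix_(l, j) if (j < i)%N then (y^t*) l j
  else if (i < j)%N then (u^t*) l j else 0.
have /det0P[a a_neq0 aM] : \det M == 0.
  rewrite (expand_det_col _ i) big1// => k _.
  by rewrite mxE !ltnn mul0r.
have ay (k : 'I_d) : (k < i)%N -> (a *m y^t*) 0 k = 0.
  move=> ki; transitivity ((a *m M) 0 k); last by rewrite aM mxE.
  by rewrite !mxE; apply: eq_bigr => l _; rewrite [in RHS]mxE ki.
have au (k : 'I_d) : (i < k)%N -> (a *m u^t*) 0 k = 0.
  move=> ik; transitivity ((a *m M) 0 k); last by rewrite aM mxE.
  by rewrite !mxE; apply: eq_bigr => l _; rewrite [in RHS]mxE ltnNge (ltnW ik) ik.
have a_gt0 : 0 < \sum_k `|a 0 k| ^+ 2.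
  rewrite lt_neqAle sumr_ge0 ?andbT// eq_sym; apply/eqP => a0; case/eqP: a_neq0.
  apply/rowP => k; rewrite mxE; apply/eqP; rewrite -normr_eq0 -sqrf_eq0.
  by apply/eqP; apply: (psumr_eq0P _ a0).
(* The squared norm of [a] is written in the coordinates of [u] on the left and of [y] on the right.
   The former live on [k <= i], where [kap k >= kap i], the latter on [k >= i], where
   [nu k <= nu i]. *)
rewrite -lecR -(ler_pM2r a_gt0) -{1}(norm_unitary a uU) -(norm_unitary a yU).
have := le_form a; rewrite !quad_conj_diag => le_sum.
rewrite !mulr_sumr; apply: le_trans (le_trans _ le_sum) _; apply: ler_sum => k _.
- have [ki|ik] := leqP k i; last by rewrite au// normr0 expr0n !mulr0.
  by rewrite ler_wpM2r ?exprn_ge0// lecR kap_noninc.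
- have [ik|ki] := leqP i k; last by rewrite ay// normr0 expr0n !mulr0.
  by rewrite ler_wpM2r ?exprn_ge0// lecR nu_noninc.
Qed.

Lemma conj_diag_perm d (z : 'M[C]_d) (f : 'I_d -> R) (s : 'S_d) :
  (row_perm s z)^t* *m diagR (f \o s) *m row_perm s z = z^t* *m diagR f *m z.
Proof.
apply/matrixP => i j; rewrite !conj_diagE [RHS](reindex_perm s).
by apply: eq_bigr => k _; rewrite !mxE.
Qed.

Lemma row_perm_unitary d (z : 'M[C]_d) (s : 'S_d) :
  z \is unitarymx -> row_perm s z \is unitarymx.
Proof.
move=> zU; rewrite row_permE; apply: mul_unitarymx zU; apply/unitarymxP.
by rewrite tr_perm_mx map_perm_mx -perm_mxM mulgV perm_mx1.
Qed.

Lemma sorting_perm d (f : 'I_d -> R) :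
  exists s : 'S_d, {homo f \o s : i j / (i <= j)%N >-> j <= i}.
Proof.
pose t := [tuple f k | k < d].
have /tuple_permP[s sE] : perm_eq (sort >=%R t) t by rewrite perm_sort.
exists s => i j ij /=.
have fE (k : 'I_d) : f (s k) = nth 0 (sort >=%R t) k.
  by rewrite sE -tnth_nth !tnth_mktuple.
have ge_tot : total (>=%R : rel R) by move=> a b; apply: le_total.
have ge_tr : transitive (>=%R : rel R) by move=> a b c ab bc; apply: le_trans bc ab.
rewrite !fE; apply: (sorted_leq_nth ge_tr (@lexx _ _) 0 (sort_sorted ge_tot t)) => //.
- by rewrite inE size_sort size_tuple.
- by rewrite inE size_sort size_tuple.
Qed.

(** The spectral theorem yields complex eigenvalues in no particular order; they are real because
    [X] is hermitian, and permuting the rows of the eigenbasis sorts them. *)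
Lemma hermitian_diag d (X : 'M[C]_d) : X^t* = X ->
  exists (z : 'M[C]_d) (f : 'I_d -> R), [/\ z \is unitarymx,
    {homo f : i j / (i <= j)%N >-> j <= i} & X = z^t* *m diagR f *m z].
Proof.
move=> Xherm.
have Xh : X \is hermsymmx by apply/is_hermitianmxP; rewrite expr0 scale1r.
have /orthomx_spectralP XE := hermitian_normalmx Xh.
have /mxOverP Dreal := hermitian_spectral_diag_real Xh.
have zU := spectral_unitarymx X.
set z := spectralmx X in XE zU; set D := spectral_diag X in XE Dreal.
pose f k := complex.Re (D 0 k).
have [s s_noninc] := sorting_perm f.
exists (row_perm s z), (f \o s); split; [exact: row_perm_unitary|exact: s_noninc|].
rewrite conj_diag_perm /diagR [LHS]XE.
have -> : D = \row_k (f k)%:C by apply/rowP => k; rewrite mxE /f RRe_real.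
by rewrite (invmx_unitary zU).
Qed.

(** [rho i] is the value of the right-hand form at the [i]-th row of [z]. It is a sum of nonnegative
    terms, which cannot all vanish because [A^t*] is invertible. *)
Lemma conj_diag_gt0 d (z A : 'M[C]_d) (rho kap : 'I_d -> R) :
    z \is unitarymx -> A \in unitmx -> (forall i, 0 < kap i) ->
    z^t* *m diagR rho *m z = A^t* *m diagR kap *m A ->
  forall i, 0 < rho i.
Proof.
move=> zU A_unit kap_gt0 XE i; set a := row i z.
have az k : (a *m z^t*) 0 k = (i == k)%:R.
  by rewrite /a -row_mul (unitarymxP zU) !mxE.
have rhoE : (rho i)%:C = \sum_k (kap k)%:C * `|(a *m A^t*) 0 k| ^+ 2.
  rewrite -quad_conj_diag -XE quad_conj_diag (bigD1 i)//= az eqxx normr1.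
  rewrite expr1n mulr1 big1 ?addr0// => k ki.
  by rewrite az eq_sym (negPf ki) normr0 expr0n mulr0.
have term_ge0 k : true -> 0 <= (kap k)%:C * `|(a *m A^t*) 0 k| ^+ 2.
  by move=> _; rewrite mulr_ge0 ?exprn_ge0// lecR ltW.
rewrite -ltcR rhoE lt_neqAle sumr_ge0// andbT.
apply/eqP => /esym sum0.
have aA : a *m A^t* = 0.
  apply/rowP => k; rewrite [RHS]mxE.
  have /eqP := psumr_eq0P term_ge0 sum0 (i := k) isT.
  by rewrite mulf_eq0 fmorph_eq0 gt_eqF//= sqrf_eq0 normr_eq0 => /eqP.
have AC_unit : A^t* \in unitmx by rewrite map_unitmx unitmx_tr.
have a0 : a = 0 by rewrite -[a](mulmxK AC_unit) aA mul0mx.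
by have := az i; rewrite a0 mul0mx mxE eqxx => /eqP; rewrite eq_sym oner_eq0.
Qed.

(** Here [E] is [D^-1]. Reversing [kap] and inverting [del] puts both lower bounds on the
    eigenvalues [nu] of [N] in non-increasing order, so both compare with [nu] index by index, and
    multiplying by [del i ^+ 2] gives the two arguments of the maximum. *)
Lemma prod_max_diag_conj d (kap del rho : 'I_d -> R) (u z : 'M[C]_d) tau :
    u \is unitarymx -> z \is unitarymx ->
    {homo kap : i j / (i <= j)%N >-> i <= j} ->
    {homo del : i j / (i <= j)%N >-> i <= j} ->
    (forall i, 0 < del i) -> 0 < tau ->
    diagR del *m (u^t* *m diagR kap *m u) *m diagR del =
      z^t* *m diagR rho *m z ->
  \prod_i Num.max (kap (rev_ord i) * del i ^+ 2) tau <=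
    \prod_i Num.max (rho i) tau.
Proof.
move=> uU zU kap_nondec del_nondec del_gt0 tau_gt0 XE.
pose E := diagR (fun k => (del k)^-1).
have DE : diagR del *m E = 1%:M.
  apply/matrixP => i j; rewrite mul_mx_diag !mxE; case: eqVneq => [<-|_].
    by rewrite mulr1n -rmorphM /= mulfV ?gt_eqF.
  by rewrite mulr0n mul0r.
have ED : E *m diagR del = 1%:M by apply: mulmx1C.
have Eherm : E^t* = E by exact: diagR_herm.
pose mu k := Num.max (rho k) tau.
pose N := E *m (z^t* *m diagR mu *m z) *m E.
have Nherm : N^t* = N.
  by rewrite /N trmx_mul map_mxM trmx_mul map_mxM conj_diag_herm Eherm mulmxA.
have [y [nu [yU nu_noninc NE]]] := hermitian_diag Nherm.
have formN (a : 'rV[C]_d) : (a *m (y^t* *m diagR nu *m y) *m a^t*) 0 0 =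
    \sum_k (mu k)%:C * `|(a *m E *m z^t*) 0 k| ^+ 2.
  by rewrite -NE -quad_conj_diag trmx_mul map_mxM /= Eherm /N !mulmxA.
(* This is [N >= K]: replacing [max(rho, tau)] by [rho] lowers the form of [N] to that of
   [E D K D E], which is [K]. *)
have nu_kap i : kap (rev_ord i) <= nu i.
  pose r : 'S_d := perm (@rev_ord_inj d).
  apply: (eigenvalue_mono (row_perm_unitary r uU) yU
            (kap := fun i => kap (rev_ord i)) _ nu_noninc) => [k l kl|a].
    by apply: kap_nondec => /=; rewrite leq_sub2l.
   rewrite [leRHS]formN.
  have -> : diagR (fun i => kap (rev_ord i)) = diagR (kap \o r).
    by congr diag_mx; apply/rowP => k; rewrite !mxE /= permE.
  rewrite [in leLHS]conj_diag_perm.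
  have -> : (a *m (u^t* *m diagR kap *m u) *m a^t*) 0 0 =
     (a *m E *m (z^t* *m diagR rho *m z) *m (a *m E)^t*) 0 0.
    rewrite -XE trmx_mul map_mxM /= Eherm; congr (_ 0 0).
    by rewrite !mulmxA -(mulmxA a E) ED mulmx1 -(mulmxA _ (diagR del) E) DE mulmx1.
  rewrite quad_conj_diag; apply: ler_sum => k _.
  by rewrite ler_wpM2r ?exprn_ge0// lecR le_max lexx.
(* This is [N >= tau E^2], obtained by replacing [max(rho, tau)] by [tau]; the smaller matrix is
   already diagonal, so its eigenbasis is the identity matrix. *)
have nu_tau i : tau * ((del i)^-1) ^+ 2 <= nu i.
  have oneU : (1%:M : 'M[C]_d) \is unitarymx.
    by apply/unitarymxP; rewrite trmx1 map_mx1 mulmx1.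
  apply: (eigenvalue_mono oneU yU
            (kap := fun i => tau * ((del i)^-1) ^+ 2) _ nu_noninc) => [k l kl|a].
    rewrite ler_pM2l// lerXn2r ?nnegrE ?invr_ge0 ?(ltW (del_gt0 _))//.
    by rewrite lef_pV2 ?posrE// del_nondec.
  rewrite [leRHS]formN quad_conj_diag trmx1 map_mx1 mulmx1.
  have -> : \sum_k (tau * ((del k)^-1) ^+ 2)%:C * `|a 0 k| ^+ 2 =
     tau%:C * \sum_k `|(a *m E) 0 k| ^+ 2.
    rewrite mulr_sumr; apply: eq_bigr => k _.
    rewrite mul_mx_diag !mxE normrM exprMn rmorphM rmorphXn /= -mulrA.
    congr (_ * _); rewrite mulrC; congr (_ * _ ^+ 2).
    by rewrite ger0_norm// lecR invr_ge0 ltW.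
  rewrite -(norm_unitary _ zU) mulr_sumr; apply: ler_sum => k _.
  by rewrite ler_wpM2r ?exprn_ge0// lecR le_max lexx orbT.
have det_conj (v : 'M[C]_d) f : v \is unitarymx ->
    \det (v^t* *m diagR f *m v) = (\prod_k f k)%:C.
  move=> vU; rewrite !det_mulmx mulrAC [_ * \det v]mulrC -det_mulmx.
  rewrite (unitarymxP vU) det1 mul1r det_diag rmorph_prod.
  by apply: eq_bigr => k _; rewrite mxE.
have prodE : \prod_i mu i = \prod_i nu i * \prod_i del i ^+ 2.
  have detN : (\prod_i nu i)%:C = \det E * (\prod_i mu i)%:C * \det E.
    by rewrite -(det_conj y _ yU) -NE /N 2!det_mulmx det_conj.
  have detD : (\prod_i del i ^+ 2)%:C = \det (diagR del) * \det (diagR del).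
    rewrite /diagR det_diag -big_split /= rmorph_prod.
    by apply: eq_bigr => k _; rewrite rmorphXn mxE.
  have detED : \det E * \det (diagR del) = 1 by rewrite -det_mulmx ED det1.
  apply: complexI; rewrite rmorphM /= detN detD mulrACA detED mulr1.
  by rewrite mulrAC detED mul1r.
rewrite -/mu prodE -big_split /=; apply: ler_prod => i _.
have d2 : 0 < del i ^+ 2 by rewrite exprn_gt0.
rewrite le_max (ltW tau_gt0) orbT /= -ler_pdivrMr// maxr_pMl ?invr_ge0 ?(ltW d2)//.
rewrite ge_max mulfK ?gt_eqF// nu_kap /=.
by rewrite -exprVn nu_tau.
Qed.

End Matrices.

(** * Spans and positive eigenvalues *)

Section Span.
Context {R : realType} {H : lmodType R[i]}.
Local Notation C := R[i].

Definition comb m n (A : 'M[C]_(m, n)) (e : 'I_n -> H) (k : 'I_m) : H :=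
  \sum_i A k i *: e i.

Lemma synthesisM m n (a : 'rV[C]_m) (A : 'M[C]_(m, n)) (e : 'I_n -> H) :
  synthesis e (a *m A) = synthesis (comb A e) a.
Proof.
rewrite /synthesis /comb; under [RHS]eq_bigr do rewrite scaler_sumr.
rewrite exchange_big /=; apply: eq_bigr => j _.
by rewrite mxE scaler_suml; apply: eq_bigr => i _; rewrite scalerA.
Qed.

Lemma lspanP n (e : 'I_n -> H) x :
  lspan e x <-> exists c : 'I_n -> C, x = \sum_i c i *: e i.
Proof.
split=> [[a _ <-]|[c ->]]; first by exists (a 0).
by exists (\row_i c i) => //; apply: eq_bigr => i _; rewrite mxE.
Qed.

Lemma lspan_sum n (e : 'I_n -> H) (I : Type) (r : seq I) (c : I -> C) (v : I -> H) :
  (forall i, lspan e (v i)) -> lspan e (\sum_(i <- r) c i *: v i).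
Proof.
move=> ev; elim/big_ind: _ => [|x y /lspanP[a ->] /lspanP[b ->]|i _].
- by apply/lspanP; exists (fun=> 0); rewrite big1// => i _; rewrite scale0r.
- apply/lspanP; exists (fun i => a i + b i); rewrite -big_split /=.
  by apply: eq_bigr => i _; rewrite scalerDl.
- have /lspanP[b ->] := ev i; apply/lspanP; exists (fun j => c i * b j).
  by rewrite scaler_sumr; apply: eq_bigr => j _; rewrite scalerA.
Qed.

Lemma lspan_gen n (e : 'I_n -> H) i : lspan e (e i).
Proof.
apply/lspanP; exists (fun j => (j == i)%:R).
rewrite (bigD1 i)//= eqxx scale1r big1 ?addr0// => j /negPf->.
by rewrite scale0r.
Qed.

Lemma lspan_le m n (e : 'I_m -> H) (f : 'I_n -> H) :
  (forall i, lspan f (e i)) -> lspan e `<=` lspan f.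
Proof. by move=> ef x /lspanP[c ->]; apply: lspan_sum. Qed.

(** Coordinates of each family in the other form matrices [A] and [B]; injectivity of the synthesis
    forces [A *m B = 1], and an identity matrix of size [m'] factors through size [n'] only if
    [m' <= n']. *)
Lemma has_dim_uniq (V : set H) m n : has_dim V m -> has_dim V n -> m = n.
Proof.
have le m' n' (e : 'I_m' -> H) (f : 'I_n' -> H) : injective (synthesis e) ->
    lspan e = lspan f -> (m' <= n')%N.
  move=> e_inj ef.
  have coord p q (g : 'I_p -> H) (h : 'I_q -> H) : lspan g = lspan h ->
      exists A : 'M[C]_(p, q), comb A h = g.
    move=> gh; have /choice[c cP] i : exists c : 'I_q -> C, g i = \sum_j c j *: h j.
      by apply/lspanP; rewrite -gh; apply: lspan_gen.
    exists (\matrix_(i, j) c i j); apply/funext => i.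
    by rewrite /comb cP; apply: eq_bigr => j _; rewrite mxE.
  have [A AE] := coord _ _ _ _ ef.
  have [B BE] := coord _ _ _ _ (esym ef).
  apply: (@mulmx1_min _ _ _ A B); apply/row_matrixP => i.
  rewrite rowE row1; apply: e_inj.
  by rewrite mulmxA !synthesisM BE AE.
move=> [e [e_inj eV]] [f [f_inj fV]]; apply/eqP; rewrite eqn_leq.
by rewrite (le _ _ e f)// ?(le _ _ f e)// ?eV ?fV.
Qed.

Lemma dimv_eq (V : set H) n : has_dim V n -> Pilot.Defs.dimv V = n.
Proof.
move=> Vn; apply: (has_dim_uniq _ Vn).
by rewrite /Pilot.Defs.dimv; apply: (@xgetPex _ 0%N [set n | has_dim V n]); exists n.
Qed.

Lemma linear_comb (T : H -> H) (I : Type) (r : seq I) (c : I -> C) (v : I -> H) :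
  linear T -> T (\sum_(i <- r) c i *: v i) = \sum_(i <- r) c i *: T (v i).
Proof.
move=> Tlin.
have T0 : T 0 = 0.
  by have := Tlin (-1) 0 0; rewrite !scaleN1r oppr0 addr0 addNr => ->.
elim: r => [|i r IHr]; first by rewrite !big_nil.
by rewrite !big_cons Tlin IHr.
Qed.

Lemma lam_noninc (S : H -> H) i j : (i <= j)%N -> lam S j <= lam S i.
Proof.
rewrite /lam /pos_eigenvalues.
(* If no list of eigenvalues exists, the default is the empty list and both entries are [0]. *)
case: xgetP => [s _ [s_sorted s_gt0 _]|_] ij; last by rewrite !nth_nil.
have [js|sj] := ltnP j (size s); last first.
  rewrite [leLHS]nth_default//.
  have [si|si] := ltnP i (size s); last by rewrite nth_default.
  by apply/ltW/s_gt0/mem_nth.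
have ge_tr : transitive (>=%R : rel R) by move=> a b c ab bc; apply: le_trans bc ab.
have is_ := leq_ltn_trans ij js.
exact: (sorted_leq_nth ge_tr (@lexx _ _) 0 s_sorted i j is_ js ij).
Qed.

Lemma lam_ge0 (S : H -> H) i : 0 <= lam S i.
Proof.
rewrite /lam /pos_eigenvalues.
case: xgetP => [s _ [_ s_gt0 _]|_]; last by rewrite nth_nil.
have [si|si] := ltnP i (size s); last by rewrite nth_default.
by apply/ltW/s_gt0/mem_nth.
Qed.

(** Two candidate lists have equal multiplicities by uniqueness of dimension, and a sorted list is
    determined by its multiplicities. *)
Lemma pos_eigenvalues_eq (S : H -> H) s : sorted >=%R s ->
    {in s, forall m, 0 < m} ->
    (forall m : R, 0 < m -> has_dim [set x | S x = m%:C *: x] (count_mem m s)) ->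
  pos_eigenvalues S = s.
Proof.
move=> s_sorted s_gt0 s_dim; rewrite /pos_eigenvalues.
case: xgetP => [t _ [t_sorted t_gt0 t_dim]|/(_ s)]; last by case.
apply: (sorted_eq _ _ t_sorted s_sorted).
- by move=> a b c ab bc; apply: le_trans bc ab.
- by move=> a b /andP[/= ab ba]; apply/le_anti/andP.
apply/allP => m; rewrite mem_cat => mst; apply/eqP.
have m_gt0 : 0 < m by case/orP: mst => [/t_gt0|/s_gt0].
exact: has_dim_uniq (t_dim m m_gt0) (s_dim m m_gt0).
Qed.

End Span.

(** * Operators diagonal in an orthonormal family *)

Section Orthonormal.
Context {R : realType} {H : completeNormedModType R[i]}.
Variable dot : {dot H for conjC}.
Local Open Scope sesquilinear_scope.
Local Notation C := R[i].
Implicit Types (x y : H) (V W : set H) (S T : H -> H).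

Lemma dotC x y : dot x y = (dot y x)^*.
Proof. by rewrite hermC expr0 mul1r. Qed.

Lemma dot_sumZl (I : Type) (r : seq I) (c : I -> C) (v : I -> H) y :
  dot (\sum_(i <- r) c i *: v i) y = \sum_(i <- r) c i * dot (v i) y.
Proof. by rewrite linear_sumlz; apply: eq_bigr => i _; rewrite linearZl_LR. Qed.

Lemma dot_sumZr (I : Type) (r : seq I) (c : I -> C) (v : I -> H) y :
  dot y (\sum_(i <- r) c i *: v i) = \sum_(i <- r) (c i)^* * dot y (v i).
Proof. by rewrite linear_sum; apply: eq_bigr => i _; rewrite linearZ. Qed.

Lemma dotDl x y z : dot (x + y) z = dot x z + dot y z.
Proof. exact: linearDl. Qed.

Lemma dotBl x y z : dot (x - y) z = dot x z - dot y z.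
Proof. exact: linearBl. Qed.

Lemma dotBr x y z : dot z (x - y) = dot z x - dot z y.
Proof. exact: linearBr. Qed.

Lemma dotZl (a : C) x y : dot (a *: x) y = a * dot x y.
Proof. exact: linearZl_LR. Qed.

Lemma dotZr (a : C) x y : dot x (a *: y) = a^* * dot x y.
Proof. exact: linearZ. Qed.

Lemma dot_eq0 x : dot x x = 0 -> x = 0.
Proof. by move/eqP; rewrite dnorm_eq0 => /eqP. Qed.

Lemma dot_sqr x y : dot x y * dot y x = `|dot x y| ^+ 2.
Proof. by rewrite normCK -dotC. Qed.

Lemma orthocomp_sum V (I : Type) (r : seq I) (c : I -> C) (v : I -> H) :
  (forall i, orthocomp dot V (v i)) -> orthocomp dot V (\sum_(i <- r) c i *: v i).
Proof.
by move=> vV y Vy; rewrite dot_sumZl big1// => i _; rewrite vV// mulr0.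
Qed.

Lemma dot_comb m m' n n' (A : 'M[C]_(m, n)) (B : 'M[C]_(m', n')) e f k l :
  dot (comb A e k) (comb B f l) =
    (A *m (\matrix_(i, j) dot (e i) (f j)) *m B^t*) k l.
Proof.
rewrite /comb dot_sumZl !mxE.
under eq_bigr do rewrite dot_sumZr mulr_sumr.
rewrite exchange_big; apply: eq_bigr => j _; rewrite !mxE mulr_suml.
by apply: eq_bigr => i _; rewrite !mxE -mulrA; congr (_ * _); rewrite mulrC.
Qed.

Section Family.
Variables (d : nat) (e : 'I_d -> H).
Hypothesis e_on : orthonormal_family dot e.

Lemma gram1 : \matrix_(i, j) dot (e i) (e j) = 1%:M.
Proof. by apply/matrixP => i j; rewrite !mxE e_on. Qed.

Lemma comb_orthonormal m (A : 'M[C]_(m, d)) :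
  A \is unitarymx -> orthonormal_family dot (comb A e).
Proof.
by move=> /unitarymxP AU i j; rewrite dot_comb gram1 mulmx1 AU mxE.
Qed.

Lemma dot_coord (c : 'I_d -> C) j : dot (\sum_i c i *: e i) (e j) = c j.
Proof.
rewrite dot_sumZl (bigD1 j)//= e_on eqxx mulr1 big1 ?addr0// => i /negPf ij.
by rewrite e_on ij mulr0.
Qed.

Lemma orthonormal_expand x : lspan e x -> x = \sum_i dot x (e i) *: e i.
Proof.
by move=> /lspanP[c ->]; apply: eq_bigr => i _; rewrite dot_coord.
Qed.

Lemma dot_expand x y : lspan e x ->
  dot x y = \sum_i dot x (e i) * dot (e i) y.
Proof. by move=> /orthonormal_expand{1}->; rewrite dot_sumZl. Qed.

Lemma orthonormal_has_dim : has_dim (lspan e) d.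
Proof.
exists e; split=> // a b /(congr1 (fun v j => dot v (e j))) ab.
by apply/rowP => j; move/(congr1 (@^~ j)) : ab; rewrite !dot_coord.
Qed.

Lemma unitary_orthonormal m (A : 'M[C]_(m, d)) :
  orthonormal_family dot (comb A e) -> A \is unitarymx.
Proof.
move=> A_on; apply/unitarymxP/matrixP => i j.
by have := A_on i j; rewrite dot_comb gram1 mulmx1 => ->; rewrite mxE.
Qed.

End Family.

(** The family need not be orthonormal: the frame operator of a canonical dual first arises in this
    form on the oblique image of an orthonormal family. *)
Definition diag_op d (e : 'I_d -> H) (f : 'I_d -> R) y : H :=
  \sum_k ((f k)%:C * dot y (e k)) *: e k.

Definition matrix_op d (e : 'I_d -> H) (X : 'M[C]_d) y : H :=
  \sum_l \sum_m (dot y (e l) * X l m) *: e m.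

Lemma diag_op_comb d (A : 'M[C]_d) (e : 'I_d -> H) (f : 'I_d -> R) :
  diag_op (comb A e) f = matrix_op e (A^t* *m diagR f *m A).
Proof.
apply/funext => y; rewrite /diag_op /matrix_op /comb exchange_big /=.
under [LHS]eq_bigr do rewrite scaler_sumr.
rewrite exchange_big; apply: eq_bigr => j _; rewrite -scaler_suml.
under eq_bigr do rewrite scalerA dot_sumZr.
rewrite -scaler_suml; congr (_ *: _).
under [RHS]eq_bigr do rewrite conj_diagE mulr_sumr.
rewrite exchange_big; apply: eq_bigr => k _.
rewrite mulr_sumr mulr_suml; apply: eq_bigr => i _.
by rewrite [in RHS]mulrC -!mulrA; congr (_ * (_ * _)); rewrite mulrC.
Qed.

Lemma diag_op_sym d (e : 'I_d -> H) (f : 'I_d -> R) x y :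
  dot (diag_op e f x) y = dot x (diag_op e f y).
Proof.
rewrite dot_sumZl dot_sumZr; apply: eq_bigr => k _.
rewrite rmorphM /= -dotC conj_Creal ?complex_real// -!mulrA.
by congr (_ * _); rewrite mulrC.
Qed.

Lemma lspan_diag_op d (e : 'I_d -> H) f y : lspan e (diag_op e f y).
Proof. by apply: lspan_sum => i; apply: lspan_gen. Qed.

Lemma diag_op_ge0 d (e : 'I_d -> H) (f : 'I_d -> R) x :
  (forall i, 0 <= f i) -> 0 <= dot (diag_op e f x) x.
Proof.
move=> f_ge0; rewrite dot_sumZl sumr_ge0// => k _.
by rewrite -mulrA dot_sqr mulr_ge0 ?exprn_ge0// lecR.
Qed.

Lemma diag_op_linear d (e : 'I_d -> H) f : linear (diag_op e f).
Proof.
move=> a x y; rewrite /diag_op scaler_sumr -big_split /=.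
apply: eq_bigr => k _; rewrite dotDl dotZl scalerA -scalerDl.
by congr (_ *: _); rewrite mulrDr mulrCA.
Qed.

Lemma diag_opM d (e : 'I_d -> H) f g : orthonormal_family dot e ->
  diag_op e f \o diag_op e g = diag_op e (f \* g).
Proof.
move=> e_on; apply/funext => y /=; apply: eq_bigr => k _.
by rewrite dot_coord// rmorphM /= mulrA.
Qed.

Lemma diag_op_gen d (e : 'I_d -> H) f k : orthonormal_family dot e ->
  diag_op e f (e k) = (f k)%:C *: e k.
Proof.
move=> e_on; rewrite /diag_op (bigD1 k)//= e_on eqxx mulr1 big1 ?addr0//.
by move=> i ik; rewrite e_on eq_sym (negPf ik) mulr0 scale0r.
Qed.

(** The [k]-th coordinate of [S y] is the product of [y] with [S (e k)], so by symmetry the values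
    on [e] determine [S] off the span as well. *)
Lemma diag_op_eq d (e : 'I_d -> H) f S : orthonormal_family dot e ->
    (forall x y, dot (S x) y = dot x (S y)) -> (forall x, lspan e (S x)) ->
    (forall k, S (e k) = (f k)%:C *: e k) ->
  S = diag_op e f.
Proof.
move=> e_on S_sym Se S_gen; apply/funext => y.
rewrite (orthonormal_expand e_on (Se y)); apply: eq_bigr => k _.
by rewrite S_sym S_gen dotZr conj_Creal ?complex_real.
Qed.

Lemma matrix_op_eq d (e : 'I_d -> H) S : orthonormal_family dot e ->
    (forall x y, dot (S x) y = dot x (S y)) -> (forall x, lspan e (S x)) ->
  S = matrix_op e (\matrix_(l, m) dot (S (e l)) (e m)).
Proof.
move=> e_on S_sym Se; apply/funext => y.
rewrite (orthonormal_expand e_on (Se y)) /matrix_op exchange_big /=.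
apply: eq_bigr => m _; rewrite -scaler_suml; congr (_ *: _).
rewrite S_sym dotC (dot_expand _ _ (Se _))// rmorph_sum /=.
apply: eq_bigr => l _; rewrite mxE rmorphM /= -!dotC mulrC.
by rewrite S_sym.
Qed.

Lemma diag_op_ex d (e : 'I_d -> H) S : orthonormal_family dot e ->
    (forall x y, dot (S x) y = dot x (S y)) -> (forall x, lspan e (S x)) ->
  exists (z : 'I_d -> H) f, orthonormal_family dot z /\ S = diag_op z f.
Proof.
move=> e_on S_sym Se; have SE := matrix_op_eq e_on S_sym Se.
set X := (X in matrix_op e X) in SE.
have X_herm : X^t* = X.
  by apply/matrixP => i j; rewrite !mxE -dotC S_sym.
have [z [f [zU _ XE]]] := hermitian_diag X_herm.
exists (comb z e), f; split; first exact: comb_orthonormal.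
by rewrite diag_op_comb// SE XE.
Qed.

(** Diagonalizing the Gram matrix replaces Gram-Schmidt: the combinations given by the rows of [z]
    are orthogonal with squared norms [f k], so dividing by the square roots of the [f k] normalizes
    them. *)
Lemma ex_orthonormal_basis V d : has_dim V d ->
  exists e : 'I_d -> H, orthonormal_basis dot V e.
Proof.
move=> [e [e_inj <-]].
pose G := \matrix_(i, j) dot (e i) (e j) : 'M[C]_d.
have G_herm : G^t* = G by apply/matrixP => i j; rewrite !mxE -dotC.
have [z [f [zU _ GE]]] := hermitian_diag G_herm.
have zGz : z *m G *m z^t* = diagR f.
  by rewrite GE !mulmxA (unitarymxP zU) mul1mx mulmxtVK.
have f_gt0 k : 0 < f k.
  rewrite -ltcR -[X in _ < X]/((f k)%:C).
  have -> : (f k)%:C = dot (comb z e k) (comb z e k).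
    by rewrite dot_comb -/G zGz !mxE eqxx mulr1n.
  rewrite dnorm_gt0; apply/eqP => ze0.
  have : row k z = 0.
    apply: e_inj; transitivity (comb z e k).
      by apply: eq_bigr => i _; rewrite mxE.
    by rewrite ze0 /synthesis big1// => i _; rewrite mxE scale0r.
  have /row_unitarymxP/(_ k k) := zU; rewrite eqxx => + z0.
  by rewrite z0 linear0l => /eqP; rewrite eq_sym oner_eq0.
pose r k := (Num.sqrt (f k))^-1.
pose A := diagR r *m z.
have A_on : orthonormal_family dot (comb A e).
  move=> k l; rewrite dot_comb -/G trmx_mul map_mxM /= !mulmxA.
  rewrite -(mulmxA _ z G) -(mulmxA _ (z *m G)) zGz.
  rewrite diagR_herm.
  rewrite mul_mx_diag mxE mul_diag_mx !mxE.
  case: eqVneq => [<-|_]; last by rewrite !mulr0n mulr0 mul0r.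
  rewrite !mulr1n -!rmorphM /=; congr (_%:C).
  by rewrite -[f k]sqr_sqrtr ?(ltW (f_gt0 k))// /r; field; rewrite gt_eqF// sqrtr_gt0.
exists (comb A e); split=> //.
have sub : lspan (comb A e) `<=` lspan e.
  by apply: lspan_le => k; apply: lspan_sum => i; apply: lspan_gen.
apply/seteqP; split=> //.
(* Orthonormality says [A *m G *m A^t* = 1], so [A] has a right inverse and the old family is
   recovered from the new one. *)
have A_unit : A \in unitmx.
  have /mulmx1_unit[//] : A *m (G *m A^t*) = 1%:M.
  by apply/matrixP => i j; rewrite mulmxA -dot_comb A_on mxE.
by move=> x [a _ <-]; exists (a *m invmx A) => //; rewrite -synthesisM mulmxKV.
Qed.

End Orthonormal.

HB.instance Definition _ (R : realType) (H : completeNormedModType R[i])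
    (dot : {dot H for conjC}) d (e : 'I_d -> H) f :=
  GRing.isLinear.Build R[i] H H *:%R (diag_op dot e f) (@diag_op_linear R H dot d e f).

(** * Adjoints, projections, square roots, pseudo-inverses, traces and eigenvalue lists *)

Section Operators.
Context {R : realType} {H : completeNormedModType R[i]}.
Variable dot : {dot H for conjC}.
Local Open Scope sesquilinear_scope.
Local Notation C := R[i].
Implicit Types (x y : H) (V W : set H) (S T : H -> H).

Lemma adjoint_eq (U : lmodType C) (dU : {dot U for conjC}) (T : U -> H)
    (S : H -> U) :
  (forall a y, dot (T a) y = dU a (S y)) -> adjoint dU dot T = S.
Proof.
move=> TS; rewrite /adjoint; case: xgetP => [S' _ TS'|/(_ S) //].
apply/funext => y; apply/eqP; rewrite -subr_eq0 -(dnorm_eq0 dU).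
by rewrite linearB /= -TS' -TS subrr.
Qed.

(* When no adjoint exists, the junk value [0] of [adjoint] makes the hypothesis
   say [T = 0] here, and that [H] is trivial in [adjoint_isometry]. *)
Lemma adjoint_self T : adjoint dot dot T = T ->
  forall x y, dot (T x) y = dot x (T y).
Proof.
rewrite /adjoint; case: xgetP => [S _ TS ST|_ <-] x y; first by rewrite TS ST.
by rewrite linear0l linear0.
Qed.

Lemma adjoint_isometry T : adjoint dot dot T \o T = id ->
  forall x y, dot (T x) (T y) = dot x y.
Proof.
rewrite /adjoint; case: xgetP => [S _ TS ST|_ T0] x y.
  by rewrite TS -[S (T y)]/((S \o T) y) ST.
have z0 (z : H) : z = 0 by move/(congr1 (fun g : H -> H => g z)) : T0 => /= <-.
by rewrite (z0 x) (z0 (T _)) !linear0l.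
Qed.

Lemma analysisE n (F : 'I_n -> H) :
  analysis dot F = fun y => \row_i dot y (F i).
Proof.
apply: adjoint_eq => a y; rewrite dot_sumZl -[RHS]/(dotmx a (\row_i dot y (F i))).
rewrite dotmxE mxE.
by apply: eq_bigr => i _; rewrite !mxE -dotC.
Qed.

Lemma frame_opE n (F : 'I_n -> H) y :
  frame_op dot F y = \sum_i dot y (F i) *: F i.
Proof.
by rewrite /frame_op /= analysisE; apply: eq_bigr => i _; rewrite mxE.
Qed.

Lemma frame_op_sym n (F : 'I_n -> H) x y :
  dot (frame_op dot F x) y = dot x (frame_op dot F y).
Proof.
rewrite !frame_opE dot_sumZl dot_sumZr; apply: eq_bigr => i _.
by rewrite -dotC mulrC.
Qed.

(** Two decompositions of [x] differ by a vector common to [V] and [W]. Asking only for closure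
    under differences covers spans and orthocomplements alike. *)
Lemma oblique_proj_eq V W x v : (forall y, V y -> W y -> y = 0) ->
    (forall y z, V y -> V z -> V (y - z)) ->
    (forall y z, W y -> W z -> W (y - z)) ->
  V v -> W (x - v) -> oblique_proj V W x = v.
Proof.
move=> VW0 VB WB Vv Wxv; rewrite /oblique_proj.
case: xgetP => [u _ [Vu Wxu]|/(_ v)]; last by case.
apply/eqP; rewrite -subr_eq0; apply/eqP/VW0; first exact: VB.
have -> : u - v = (x - v) - (x - u) by rewrite opprB [RHS]addrC addrA subrK.
exact: WB.
Qed.

Lemma lspanB n (e : 'I_n -> H) y z : lspan e y -> lspan e z -> lspan e (y - z).
Proof.
(* The difference is a linear combination indexed by [bool], to which [lspan_sum] applies. *)
move=> ey ez; have -> : y - z = \sum_(b : bool) (if b then 1 else -1) *: (if b then y else z).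
  by rewrite big_bool /= scale1r scaleN1r.
by apply: lspan_sum => -[].
Qed.

Lemma orthocompB V y z :
  orthocomp dot V y -> orthocomp dot V z -> orthocomp dot V (y - z).
Proof. by move=> Vy Vz v Vv; rewrite dotBl (Vy _ Vv) (Vz _ Vv) subr0. Qed.

Lemma sub_expand_orthocomp d (e : 'I_d -> H) x : orthonormal_family dot e ->
  orthocomp dot (lspan e) (x - diag_op dot e (fun=> 1) x).
Proof.
move=> e_on v ev; rewrite dotBl diag_op_sym.
rewrite [diag_op _ _ _ v](_ : _ = v) ?subrr//.
rewrite {2}(orthonormal_expand e_on ev); apply: eq_bigr => k _.
by rewrite rmorph1 mul1r.
Qed.

Lemma orth_proj_eq V d (e : 'I_d -> H) : orthonormal_basis dot V e ->
  orth_proj dot V = diag_op dot e (fun=> 1).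
Proof.
move=> [e_on <-]; apply/funext => x; apply: oblique_proj_eq.
- by move=> y ey /(_ y ey)/dot_eq0.
- exact: lspanB.
- exact: orthocompB.
- exact: lspan_diag_op.
- exact: sub_expand_orthocomp.
Qed.

Lemma diag_op1_id d (e : 'I_d -> H) x : orthonormal_family dot e ->
  lspan e x -> diag_op dot e (fun=> 1) x = x.
Proof.
move=> e_on ex; rewrite {2}(orthonormal_expand e_on ex).
by apply: eq_bigr => k _; rewrite rmorph1 mul1r.
Qed.

Lemma dot_unit_le e x : dot e e = 1 -> `|dot x e| ^+ 2 <= dot x x.
Proof.
move=> e1; rewrite -subr_ge0.
have -> : dot x x - `|dot x e| ^+ 2 = dot (x - dot x e *: e) (x - dot x e *: e).
  rewrite dotBl !dotBr !dotZl !dotZr e1 mulr1.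
  by rewrite -dotC -dot_sqr; ring.
exact: dnorm_ge0.
Qed.

Lemma diag_op_bounded d (e : 'I_d -> H) f : norm_of_dot dot ->
  orthonormal_family dot e -> bounded_op (diag_op dot e f).
Proof.
move=> Hdot e_on; split; first exact: diag_op_linear.
apply: bounded_linear_continuous; apply/linear_boundedP.
have e1 k : `|e k| = 1.
  by apply/eqP; rewrite -(@pexpr_eq1 _ _ 2)// Hdot e_on eqxx.
(* By Bessel's inequality for the unit vector [e k], the [k]-th term is bounded by [|f k|] times the
   norm of [x]. *)
exists (\sum_k `|(f k)%:C|); split; first by rewrite sum_real.
move=> r fr x; apply: le_trans (ler_norm_sum _ _ _) _.
apply: (@le_trans _ _ ((\sum_k `|(f k)%:C|) * `|x|)).
  rewrite mulr_suml; apply: ler_sum => k _.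
  rewrite normrZ normrM e1 mulr1 ler_wpM2l//.
  rewrite -(@ler_pXn2r _ 2)// ?nnegrE// Hdot.
  by apply: dot_unit_le; rewrite e_on eqxx.
by rewrite ler_wpM2r// ltW.
Qed.

(** The square root is chosen by [xget], so a positive root has to be exhibited: [Q P Q] has finite
    rank, and its eigenvalues, squared norms of the [P (Q (z k))], have square roots. *)
Lemma op_abs_sqr V W m d (e : 'I_m -> H) (w : 'I_d -> H)
    (B := op_abs dot (orth_proj dot V \o orth_proj dot W)) :
    norm_of_dot dot -> orthonormal_basis dot V e -> orthonormal_basis dot W w ->
  linear B /\ B \o B = orth_proj dot W \o orth_proj dot V \o orth_proj dot W.
Proof.
move=> Hdot eV wW; have [e_on _] := eV; have [w_on _] := wW.
rewrite {}/B (orth_proj_eq eV) (orth_proj_eq wW).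
set P := diag_op dot e _; set Q := diag_op dot w _.
have PE : P \o P = P.
  by rewrite /P diag_opM//; congr diag_op; apply/funext => k; rewrite /= mulr1.
rewrite /op_abs (@adjoint_eq _ _ _ (Q \o P)) => [|x y]; last by rewrite /= !diag_op_sym.
have -> : (Q \o P) \o (P \o Q) = Q \o P \o Q.
  by apply/funext => x; rewrite -[in RHS]PE.
set S := Q \o P \o Q.
have [z [f [z_on SE]]] : exists (z : 'I_d -> H) f,
    orthonormal_family dot z /\ S = diag_op dot z f.
  apply: (diag_op_ex w_on) => [x y|x]; last exact: lspan_diag_op.
  by rewrite /S /= !diag_op_sym.
have f_ge0 k : 0 <= f k.
  rewrite -lecR; have -> : (f k)%:C = dot (S (z k)) (z k).
    by rewrite SE diag_op_gen// dotZl /= z_on eqxx mulr1.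
  by rewrite /S -PE /= diag_op_sym diag_op_sym dnorm_ge0.
suff [[[lin _] _] sq] : [set B | positive_op dot B /\ B \o B = S] (op_sqrt dot S) by [].
apply: xgetPex.
exists (diag_op dot z (fun k => Num.sqrt (f k))); split; first split.
- exact: diag_op_bounded.
- by move=> x; apply: diag_op_ge0 => k; apply: sqrtr_ge0.
rewrite diag_opM// SE; congr diag_op; apply/funext => k /=.
by rewrite -expr2 sqr_sqrtr.
Qed.

(** Inverting the [f k] provides one pseudo-inverse; the values on [b] of the one chosen by [xget]
    are then read off from the Penrose equations. *)
Lemma pinv_diag_op d (b : 'I_d -> H) (f : 'I_d -> R) : norm_of_dot dot ->
    orthonormal_family dot b -> (forall i, 0 < f i) ->
  linear (Pilot.Defs.pinv dot (diag_op dot b f)) /\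
  forall k, Pilot.Defs.pinv dot (diag_op dot b f) (b k) = ((f k)^-1)%:C *: b k.
Proof.
move=> Hdot b_on f_gt0; set S := diag_op dot b f.
have [] : [set B : H -> H | bounded_op B /\
    [/\ S \o B \o S = S, B \o S \o B = B,
        adjoint dot dot (S \o B) = S \o B &
        adjoint dot dot (B \o S) = B \o S]] (Pilot.Defs.pinv dot S).
  apply: xgetPex; exists (diag_op dot b (fun i => (f i)^-1)).
  have f1 : f \* (fun i => (f i)^-1) = fun=> 1.
    by apply/funext => i; rewrite /= mulfV// gt_eqF.
  have f1' : (fun i => (f i)^-1) \* f = fun=> 1.
    by apply/funext => i; rewrite /= mulVf// gt_eqF.
  split; first exact: diag_op_bounded.
  rewrite !diag_opM// f1 f1'; split.
  - by congr diag_op; apply/funext => i; rewrite /= mul1r.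
  - by congr diag_op; apply/funext => i; rewrite /= mul1r.
  - by apply: adjoint_eq => x y; apply: diag_op_sym.
  - by apply: adjoint_eq => x y; apply: diag_op_sym.
set B := Pilot.Defs.pinv dot S => -[Blin _] [SBS _ _ /adjoint_self BS_sym]; split=> // k.
have S_b i : S (b i) = (f i)%:C *: b i by apply: diag_op_gen.
have S0 x : S x = 0 -> forall i, dot x (b i) = 0.
  move=> Sx0 i; have : dot (S x) (b i) = 0 by rewrite Sx0 linear0l.
  rewrite diag_op_sym diag_op_gen// dotZr conj_Creal ?complex_real// => /eqP.
  by rewrite mulf_eq0 fmorph_eq0 gt_eqF//= => /eqP.
(* [S r = 0], so [r] is orthogonal to [b k]; it is also orthogonal to [B (S (b k))], because
   [B \o S] is symmetric and kills [r]. Hence [r] is orthogonal to itself. *)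
pose r := b k - B (S (b k)).
have Sr : S r = 0.
  have -> : S r = S (b k) - S (B (S (b k))) by exact: (raddfB (diag_op dot b f)).
  by rewrite -[S (B _)]/((S \o B \o S) (b k)) SBS subrr.
have B0 : B 0 = 0 by have := Blin (-1) 0 0; rewrite !scaleN1r oppr0 addr0 addNr => ->.
have r0 : r = 0.
  apply: (dot_eq0 (dot := dot)); rewrite {2}/r dotBr S0// sub0r.
  by rewrite -[B (S _)]/((B \o S) (b k)) -BS_sym /= Sr B0 linear0l oppr0.
have : B (S (b k)) = b k by move/eqP: r0; rewrite subr_eq0 => /eqP.
rewrite S_b => BS; rewrite -[in RHS]BS.
have -> : B ((f k)%:C *: b k) = (f k)%:C *: B (b k).
  by have := Blin (f k)%:C (b k) 0; rewrite B0 !addr0.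
by rewrite scalerA -rmorphM /= mulVf ?gt_eqF// rmorph1 scale1r.
Qed.

(** Whichever orthonormal [e] is chosen, its span contains the range and hence each [b k], as
    [f k > 0]; Parseval's identity in [e] then gives [f k] the total weight [1]. *)
Lemma optrace_diag_op d (b : 'I_d -> H) (f : 'I_d -> R) :
    orthonormal_family dot b -> (forall i, 0 < f i) ->
  optrace dot (diag_op dot b f) = (\sum_k f k)%:C.
Proof.
move=> b_on f_gt0; set S := diag_op dot b f.
rewrite /optrace; case: xgetP => [c _ [n [e [e_on Se ->]]]|noc].
  have be k : lspan e (b k).
    apply: Se; exists (((f k)^-1)%:C *: b k) => //.
    by rewrite /S linearZ /= diag_op_gen// scalerA -rmorphM /= mulVf ?gt_eqF// rmorph1 scale1r.
  under eq_bigr do rewrite dot_sumZl.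
  rewrite exchange_big rmorph_sum; apply: eq_bigr => k _.
  under eq_bigr do rewrite -mulrA.
  rewrite -mulr_sumr; under eq_bigr do rewrite mulrC.
  by rewrite -(dot_expand e_on _ (be k)) b_on eqxx mulr1.
case: (noc (\sum_i dot (S (b i)) (b i))); exists d, b; split=> //.
by move=> _ [x _ <-]; apply: lspan_diag_op.
Qed.

(** An eigenvector [x] for [m > 0] equals [S x] divided by [m], so it lies in the span of [b], and
    only its coordinates with [f k = m] survive. The eigenspace is thus spanned by these [b k]. *)
Lemma pos_eigenvalues_diag_op d (b : 'I_d -> H) (f : 'I_d -> R) :
    orthonormal_family dot b -> (forall i, 0 < f i) ->
  pos_eigenvalues (diag_op dot b f) = sort >=%R (codom f).
Proof.
move=> b_on f_gt0; apply: pos_eigenvalues_eq.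
- by apply: sort_sorted => a c; apply: le_total.
- by move=> m; rewrite mem_sort => /codomP[i ->].
move=> m m_gt0.
have -> : count_mem m (sort >=%R (codom f)) = #|[set k | f k == m]|%SET.
  rewrite (seq.permP (permEl (perm_sort _ _))) /codom /image_mem count_map.
  rewrite -sum1_count big_enum_cond -sum1_card.
  by apply: eq_bigl => k; rewrite !inE.
set A := [set k | f k == m]%SET.
pose e (i : 'I_#|A|) := b (enum_val i).
have e_on : orthonormal_family dot e.
  by move=> i j; rewrite b_on (inj_eq enum_val_inj).
suff -> : [set x | diag_op dot b f x = m%:C *: x] = lspan e.
  exact: (orthonormal_has_dim e_on).
apply/seteqP; split=> [x /= Sx|x /lspanP[c ->] /=]; last first.
  rewrite (linear_comb _ _ _ (@diag_op_linear _ _ _ _ _ _)) scaler_sumr.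
  apply: eq_bigr => i _; rewrite diag_op_gen// !scalerA mulrC.
  by have := enum_valP i; rewrite inE => /eqP ->.
have x_coord k : f k != m -> dot x (b k) = 0.
  move=> fk; have : dot (diag_op dot b f x) (b k) = m%:C * dot x (b k).
    by rewrite Sx dotZl.
  rewrite dot_coord// => /eqP; rewrite -subr_eq0 -mulrBl mulf_eq0.
  by rewrite subr_eq0 (inj_eq (@complexI R)) (negPf fk) => /eqP.
have -> : x = (m^-1)%:C *: diag_op dot b f x.
  by rewrite Sx scalerA -rmorphM /= mulVf ?gt_eqF// rmorph1 scale1r.
apply/lspanP; exists (fun i => dot x (e i)).
rewrite -(big_enum_val (fun k => dot x (b k) *: b k)).
rewrite scaler_sumr [RHS]big_mkcond; apply: eq_bigr => k _.
rewrite inE; case: eqP => [->|/eqP fk]; last by rewrite x_coord// mulr0 scale0r scaler0.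
by rewrite scalerA mulrA -rmorphM /= mulVf ?gt_eqF// rmorph1 mul1r.
Qed.

Section Lam.
Variables (d : nat) (b : 'I_d -> H) (f : 'I_d -> R).
Hypotheses (b_on : orthonormal_family dot b) (f_gt0 : forall i, 0 < f i).
Let S := diag_op dot b f.

Lemma lam_gt0 i : (i < d)%N -> 0 < lam S i.
Proof.
move=> id; rewrite /lam pos_eigenvalues_diag_op//.
have : nth 0 (sort >=%R (codom f)) i \in sort >=%R (codom f).
  by apply: mem_nth; rewrite size_sort size_codom card_ord.
by rewrite mem_sort => /codomP[j ->].
Qed.

(** Commutativity of [op] absorbs the sorting; it serves for sums in the trace and for products of
    maxima. *)
Lemma big_lam (T : Type) (idx : T) (op : Monoid.com_law idx) (g : R -> T) :
  \big[op/idx]_(i < d) g (lam S i) = \big[op/idx]_k g (f k).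
Proof.
transitivity (\big[op/idx]_(m <- sort >=%R (codom f)) g m).
  rewrite (big_nth 0) size_sort size_codom card_ord big_mkord.
  by apply: eq_bigr => i _; rewrite /lam pos_eigenvalues_diag_op.
rewrite (perm_big (codom f)) ?perm_sort//= /codom /image_mem big_map.
by rewrite big_enum.
Qed.

End Lam.

End Operators.

(** * Canonical oblique duals *)

Section CanonicalDual.
Context {R : realType} {H : completeNormedModType R[i]}.
Variable dot : {dot H for conjC}.
Local Open Scope sesquilinear_scope.
Local Notation C := R[i].
Implicit Types (x y : H) (U T : H -> H).

Section Oblique.
Variables (V W : set H) (d : nat) (e : 'I_d -> H).
Hypotheses (VW : direct_sum_full V (orthocomp dot W)) (eV : lspan e = V).
Let Q := oblique_proj V (orthocomp dot W).

Lemma oblique_projP x : V (Q x) /\ orthocomp dot W (x - Q x).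
Proof.
apply: (@xgetPex _ 0 [set v | V v /\ orthocomp dot W (x - v)]).
have [v [y [Vv Wy ->]]] := VW.1 x.
by exists v; split=> //; rewrite addrC addKr.
Qed.

Lemma oblique_proj_unique x v :
  V v -> orthocomp dot W (x - v) -> Q x = v.
Proof.
apply: oblique_proj_eq; last exact: orthocompB.
- move=> y Vy Wy; have : (V `&` orthocomp dot W) y by [].
  by rewrite VW.2.
- by rewrite -eV; apply: lspanB.
Qed.

Lemma oblique_proj_sum (I : Type) (r : seq I) (c : I -> C) (v : I -> H) :
  Q (\sum_(i <- r) c i *: v i) = \sum_(i <- r) c i *: Q (v i).
Proof.
apply: oblique_proj_unique.
  by rewrite -eV; apply: lspan_sum => i; rewrite eV; apply: (oblique_projP _).1.
rewrite -sumrB; under eq_bigr do rewrite -scalerBr.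
by apply: orthocomp_sum => i; apply: (oblique_projP _).2.
Qed.

Lemma oblique_proj_id y : V y -> Q y = y.
Proof.
move=> Vy; apply: oblique_proj_unique => //.
by rewrite subrr => v _; rewrite linear0l.
Qed.

(** [Q] fixes [V] and factors through the synthesis of [G], so [G] spans all of [V]. This fixes the
    number of terms in the convex potential. *)
Lemma lspan_oblique_dual n (F G : 'I_n -> H) :
  oblique_dual dot V W F G -> lspan G = V.
Proof.
move=> [VG GF]; apply/seteqP; split.
  by rewrite -eV; apply: lspan_le => i; rewrite eV.
move=> y Vy; rewrite -(oblique_proj_id Vy) /Q -GF /=.
by exists (analysis dot F y).
Qed.

(** The dual is the combination of the [Q (b j)] with coefficient matrix [A]. Since [F] has frame
    operator diagonal in [b], [A^t* *m A] is diagonal with entries [(f k)^-1], and the cross terms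
    cancel. *)
Lemma frame_op_canonical_dual n (F : 'I_n -> H) m (b : 'I_m -> H) (f : 'I_m -> R) :
    norm_of_dot dot -> orthonormal_family dot b -> (forall i, 0 < f i) ->
    (forall i, lspan b (F i)) -> frame_op dot F = diag_op dot b f ->
  frame_op dot (canonical_dual dot V W F) =
    diag_op dot (Q \o b) (fun k => (f k)^-1).
Proof.
move=> Hdot b_on f_gt0 bF SE; apply/funext => y.
have [B_lin Bb] := pinv_diag_op Hdot b_on f_gt0.
pose A := \matrix_(i, j) (dot (F i) (b j) * ((f j)^-1)%:C).
have -> : canonical_dual dot V W F = comb A (Q \o b).
  apply/funext => i; rewrite /canonical_dual SE.
  rewrite {1}(orthonormal_expand b_on (bF i)) (linear_comb _ _ _ B_lin).
  under eq_bigr do rewrite Bb scalerA.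
  by rewrite -/Q oblique_proj_sum; apply: eq_bigr => j _; rewrite mxE.
have gramA j k : \sum_i (A i j)^* * A i k = ((f k)^-1)%:C * (j == k)%:R.
  have := congr1 (fun v => dot v (b k)) (congr1 (fun T : H -> H => T (b j)) SE).
  rewrite /= frame_opE diag_op_gen// dot_sumZl dotZl b_on => FF.
  transitivity (((f j)^-1)%:C * ((f k)^-1)%:C *
      \sum_i dot (b j) (F i) * dot (F i) (b k)).
    rewrite mulr_sumr; apply: eq_bigr => i _; rewrite !mxE rmorphM /= -dotC.
    rewrite conj_Creal ?complex_real//.
    by rewrite mulrACA mulrC.
  rewrite FF; case: eqVneq => [->|_]; last by rewrite !mulr0.
  by rewrite !mulr1 mulrAC -rmorphM /= mulVf ?gt_eqF// rmorph1 mul1r.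
rewrite frame_opE /diag_op /comb.
under eq_bigr do rewrite scaler_sumr.
rewrite exchange_big; apply: eq_bigr => k _.
under eq_bigr do rewrite scalerA dot_sumZr mulr_suml.
rewrite -scaler_suml exchange_big (bigD1 k)//= [X in _ + X]big1 ?addr0 => [|j jk].
  have := gramA k k; rewrite eqxx mulr1 => <-; congr (_ *: _).
  rewrite mulr_suml.
  by apply: eq_bigr => i _; rewrite mulrAC.
transitivity ((\sum_i (A i j)^* * A i k) * dot y (Q (b j))).
  by rewrite mulr_suml; apply: eq_bigr => i _; rewrite mulrAC.
by rewrite gramA (negPf jk) mulr0 mul0r.
Qed.

End Oblique.

Lemma frame_op_isometry U d (x : 'I_d -> H) n (F : 'I_n -> H) (f : 'I_d -> R) :
    linear U -> (forall y z, dot (U y) (U z) = dot y z) ->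
    orthonormal_family dot x -> (forall i, lspan x (F i)) ->
    (forall j, frame_op dot F (x j) = (f j)%:C *: x j) ->
  [/\ orthonormal_family dot (U \o x), forall i, lspan (U \o x) ((U \o F) i) &
      frame_op dot (U \o F) = diag_op dot (U \o x) f].
Proof.
move=> Ulin Uiso x_on xF Fx.
have Ux_on : orthonormal_family dot (U \o x) by move=> i j; rewrite /= Uiso x_on.
have UF i : lspan (U \o x) ((U \o F) i).
  have /lspanP[c Fi] := xF i; apply/lspanP; exists c.
  by rewrite /= Fi (linear_comb _ _ _ Ulin).
split=> //; apply: diag_op_eq => // [y z|y|k].
- exact: frame_op_sym.
- by rewrite frame_opE; apply: lspan_sum.
- rewrite frame_opE /=; under eq_bigr do rewrite Uiso.
  rewrite -(linear_comb _ _ _ Ulin) -frame_opE Fx.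
  (* Homogeneity of [U] is the case of a combination with a single term. *)
  by have := linear_comb [:: tt] (fun=> (f k)%:C) (fun=> x k) Ulin; rewrite !big_seq1.
Qed.

(** Squaring the absolute value gives [Pw (P (w j)) = cos^2 w j], so the [P (w j)] are orthogonal
    with norms [cos (theta j)]; [v j] is the normalized [P (w j)]. *)
Lemma oblique_proj_principal V W d (theta : 'I_d -> R) (w : 'I_d -> H) :
    norm_of_dot dot -> has_dim V d -> direct_sum_full V (orthocomp dot W) ->
    (forall j, 0 <= cos (theta j)) -> principal_vectors dot V W theta w ->
  (forall j, 0 < cos (theta j)) /\
  exists v : 'I_d -> H, orthonormal_family dot v /\ forall j,
    oblique_proj V (orthocomp dot W) (w j) = ((cos (theta j))^-1)%:C *: v j.
Proof.
move=> Hdot dimV VW cos_ge0 [wW Bw].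
have [e eVb] := ex_orthonormal_basis dot dimV.
have [w_on wWs] := wW; have [e_on eV] := eVb.
have [B_lin BB] := op_abs_sqr Hdot eVb wW.
set B := op_abs _ _ in Bw B_lin BB.
rewrite (orth_proj_eq eVb) (orth_proj_eq wW) in BB.
set P := diag_op dot e _ in BB; set Pw := diag_op dot w _ in BB.
have Pw_id y : W y -> Pw y = y by rewrite -wWs; apply: diag_op1_id.
have Ww j : W (w j) by rewrite -wWs; apply: lspan_gen.
have PP y : P (P y) = P y.
  by apply: diag_op1_id => //; apply: lspan_diag_op.
have PwP j : Pw (P (w j)) = (cos (theta j) ^+ 2)%:C *: w j.
  rewrite -{1}(Pw_id _ (Ww j)) -[LHS]/((Pw \o P \o Pw) (w j)) -BB /= Bw.
  have := linear_comb [:: tt] (fun=> (cos (theta j))%:C) (fun=> w j) B_lin.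
  by rewrite !big_seq1 => ->; rewrite Bw scalerA -rmorphM expr2.
have dotP i j : dot (P (w i)) (P (w j)) = (cos (theta i) ^+ 2)%:C * (i == j)%:R.
  rewrite -diag_op_sym -/P PP -{1}(Pw_id _ (Ww j)) -diag_op_sym -/Pw PwP dotZl.
  by rewrite w_on.
(* A zero cosine would make [w j] orthogonal to [V]; being in [W], it is also orthogonal to the
   other summand, hence to itself. *)
have cos_gt0 j : 0 < cos (theta j).
  rewrite lt_neqAle cos_ge0 andbT; apply/eqP => cos0.
  have Pw0 : P (w j) = 0.
    by apply: (dot_eq0 (dot := dot)); rewrite dotP -cos0 expr0n mul0r.
  have Vw : orthocomp dot V (w j).
    by rewrite -[w j]subr0 -Pw0 -eV; apply: sub_expand_orthocomp.
  have [v [y [Vv Wy wE]]] := VW.1 (w j).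
  have : dot (w j) (w j) = 0.
    rewrite {2}wE -[y]opprK dotBr (Vw _ Vv) dotC.
    have -> : dot (- y) (w j) = - dot y (w j) by rewrite -scaleN1r dotZl mulN1r.
    by rewrite (Wy _ (Ww j)) oppr0 conjC0 subr0.
  by rewrite w_on eqxx => /eqP; rewrite oner_eq0.
split=> //; exists (fun j => ((cos (theta j))^-1)%:C *: P (w j)); split.
  move=> i j; rewrite dotZl dotZr dotP conj_Creal ?complex_real//.
  case: eqVneq => [->|_]; last by rewrite !mulr0.
  rewrite mulr1 -!rmorphM /= -[RHS](rmorph1 (real_complex R)).
  by congr (_%:C); field; rewrite gt_eqF.
move=> j; rewrite scalerA -rmorphM -[P (w j)]/(diag_op dot e (fun=> 1) (w j)).
apply: (oblique_proj_unique VW eV).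
  rewrite -eV; have := lspan_sum [:: tt]
    (fun=> ((cos (theta j))^-1 * (cos (theta j))^-1)%:C)
    (fun=> lspan_diag_op dot e (fun=> 1) (w j)).
  by rewrite big_seq1.
(* Tested against [W], [P (w j)] acts as [cos^2 w j], so dividing it by [cos^2] leaves a difference
   with [w j] orthogonal to [W]. *)
move=> y Wy; rewrite dotBl dotZl.
have -> : dot (P (w j)) y = (cos (theta j) ^+ 2)%:C * dot (w j) y.
  by rewrite -{1}(Pw_id _ Wy) -diag_op_sym -/Pw PwP dotZl.
rewrite mulrA -rmorphM /= (_ : _ * _ * _ = 1); last first.
  by field; rewrite gt_eqF.
by rewrite rmorph1 mul1r subrr.
Qed.

Lemma diag_op_spectral d (v : 'I_d -> H) (u : 'M[C]_d) (kap del : 'I_d -> R) :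
    orthonormal_family dot v -> u \is unitarymx ->
    {homo kap : i j / (i <= j)%N >-> i <= j} ->
    {homo del : i j / (i <= j)%N >-> i <= j} ->
    (forall i, 0 < kap i) -> (forall i, 0 < del i) ->
  exists (z : 'I_d -> H) (rho : 'I_d -> R), [/\ orthonormal_family dot z,
    forall i, 0 < rho i,
    diag_op dot (comb (u *m diagR del) v) kap = diag_op dot z rho &
    forall tau, 0 < tau ->
      \prod_i Num.max (kap (rev_ord i) * del i ^+ 2) tau <=
        \prod_i Num.max (rho i) tau].
Proof.
move=> v_on uU kap_nondec del_nondec kap_gt0 del_gt0.
set A := u *m diagR del.
have AE : A^t* *m diagR kap *m A = diagR del *m (u^t* *m diagR kap *m u) *m diagR del.
  by rewrite /A trmx_mul map_mxM /= diagR_herm !mulmxA.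
have [z [rho [zU _ XE]]] := hermitian_diag (conj_diag_herm A kap).
have A_unit : A \in unitmx.
  rewrite unitmx_mul unitarymx_unit//= unitmxE det_diag unitfE.
  apply/prodf_neq0 => i _; rewrite mxE. by rewrite fmorph_eq0 gt_eqF.
exists (comb z v), rho; split.
- exact: comb_orthonormal.
- exact: conj_diag_gt0 zU A_unit kap_gt0 (esym XE).
- by rewrite !diag_op_comb XE.
- by move=> tau tau_gt0; apply: (prod_max_diag_conj uU zU) => //; rewrite -AE.
Qed.

Lemma lam_log_submajorized d (z0 z : 'I_d -> H) (f0 f : 'I_d -> R) :
    orthonormal_family dot z0 -> orthonormal_family dot z ->
    (forall i, 0 < f0 i) -> (forall i, 0 < f i) ->
    (forall tau, 0 < tau ->
      \prod_i Num.max (f0 i) tau <= \prod_i Num.max (f i) tau) ->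
  log_submajorized d (lam (diag_op dot z0 f0)) (lam (diag_op dot z f)).
Proof.
move=> z0_on z_on f0_gt0 f_gt0 le_prod; apply: log_submajorized_max.
- by move=> i; apply: lam_gt0.
- by move=> i; apply: lam_gt0.
- by move=> i j /andP[ij _]; apply: lam_noninc.
move=> tau tau_gt0.
by rewrite !(big_lam _ _ _ (fun m => Num.max m tau))//; apply: le_prod.
Qed.

End CanonicalDual.

(** * Comparison of [U0] with an arbitrary [U] *)

Theorem theorem4p7 (R : realType) (H : completeNormedModType R[i])
  (dot : {dot H for conjC}) (Hdot : norm_of_dot dot) (Hsep : separable_space H)
  (V W : set H) (d : nat) (dimV : has_dim V d) (dimW : has_dim W d)
  (VW : direct_sum_full V (orthocomp dot W))
  (theta : 'I_d -> R) (Htheta : principal_angles dot V W theta)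
  (w : 'I_d -> H) (Hw : principal_vectors dot V W theta w)
  (n : nat) (F : 'I_n -> H) (HF : frame_for W F) (dn : (2 * d <= n)%N)
  (x : 'I_d -> H) (Hx : orthonormal_basis dot W x)
  (Hxeig : forall j, frame_op dot F (x j) = (lam (frame_op dot F) j)%:C *: x j)
  (U0 : H -> H) (U0unitary : unitary_op dot U0)
  (HU0 : forall j, U0 (x j) = w (rev_ord j))
  (U : H -> H) (Uunitary : unitary_op dot U) (HU : U @` W = W) :
  optrace dot (frame_op dot (canonical_dual dot V W (U0 \o F)))
    <= optrace dot (frame_op dot (canonical_dual dot V W (U \o F)))
  /\
  forall (t : R) (G G0 : 'I_n -> H),
    optrace dot (frame_op dot (canonical_dual dot V W (U \o F))) <= t%:C ->
    optimal_dual dot V W d t (U \o F) G ->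
    optimal_dual dot V W d t (U0 \o F) G0 ->
    forall h : R -> R, convex_nonneg h ->
      convex_potential dot h G0 <= convex_potential dot h G.
Proof.
have [wW _] := Hw; have [w_on wWs] := wW; have [x_on xW] := Hx.
have [theta_itv theta_nondec _] := Htheta.
have cos_ge0 j : 0 <= cos (theta j).
  have /andP[t0 t1] := theta_itv j; apply: cos_ge0_pihalf.
  by rewrite t1 (le_trans _ t0)// oppr_le0 divr_ge0// pi_ge0.
have [cos_gt0 [v [v_on Qw]]] := oblique_proj_principal Hdot dimV VW cos_ge0 Hw.
have [e [_ eV]] := ex_orthonormal_basis dot dimV.
have xF i : lspan x (F i) by rewrite xW -HF; apply: lspan_gen.
(* If this eigenvalue vanished, [x j] would be orthogonal to every [F i], hence to itself, as [F]
   spans [W]. *)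
have lamF_gt0 (j : 'I_d) : 0 < lam (frame_op dot F) j.
  rewrite lt_neqAle lam_ge0 andbT; apply/eqP => lam0.
  have : dot (frame_op dot F (x j)) (x j) = 0.
    by rewrite Hxeig -lam0 scale0r linear0l.
  rewrite frame_opE dot_sumZl => /psumr_eq0P sum0.
  have xjF i : dot (F i) (x j) = 0.
    apply/eqP; rewrite -normr_eq0 -sqrf_eq0 -dot_sqr mulrC; apply/eqP.
    by apply: sum0 => // k _; rewrite mulrC dot_sqr exprn_ge0.
  have : lspan F (x j) by rewrite HF -xW; apply: lspan_gen.
  move=> /lspanP[c xE]; have : dot (x j) (x j) = 0.
    by rewrite {1}xE dot_sumZl big1// => i _; rewrite xjF mulr0.
  by rewrite x_on eqxx => /eqP; rewrite oner_eq0.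
(* [kap] lists the eigenvalues of [K] and [del] the diagonal of [D], both non-decreasing. *)
pose kap j := (lam (frame_op dot F) (j : 'I_d))^-1.
pose del j := (cos (theta j))^-1.
have kap_gt0 j : 0 < kap j by rewrite invr_gt0.
have del_gt0 j : 0 < del j by rewrite invr_gt0.
have kap_nondec : {homo kap : i j / (i <= j)%N >-> i <= j}.
  by move=> i j ij; rewrite lef_pV2 ?posrE// lam_noninc.
have del_nondec : {homo del : i j / (i <= j)%N >-> i <= j}.
  have in0pi j : theta j \in `[0, pi].
    rewrite in_itv /=; have /andP[-> t1] := theta_itv j.
    by rewrite (le_trans t1)// ler_pdivrMr// ler_peMr ?pi_ge0// ler1n.
  move=> i j ij; rewrite lef_pV2 ?posrE//.
  have := theta_nondec i j ij; rewrite le_eqVlt => /predU1P[->//|tij].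
  by rewrite ltW// ltr_cos.
pose Q := oblique_proj V (orthocomp dot W).
have dualE (U' : H -> H) : unitary_op dot U' -> lspan (U' \o x) = W ->
    [/\ orthonormal_family dot (U' \o x) &
    frame_op dot (canonical_dual dot V W (U' \o F)) =
      diag_op dot (Q \o (U' \o x)) kap].
  move=> [[U'_lin _] /adjoint_isometry U'_iso _] _.
  have [Ux_on UxF SE] := frame_op_isometry U'_lin U'_iso x_on xF Hxeig.
  by split=> //; apply: (frame_op_canonical_dual VW eV Hdot Ux_on lamF_gt0 UxF SE).
have Ux : lspan (U \o x) = W.
  have [[U_lin _] _ _] := Uunitary; rewrite -HU -xW; apply/seteqP; split.
    move=> _ /lspanP[c ->]; exists (\sum_i c i *: x i); last exact: linear_comb.
    by apply/lspanP; exists c.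
  move=> _ [_ /lspanP[c ->] <-]; rewrite (linear_comb _ _ _ U_lin).
  by apply/lspanP; exists c.
have U0x : U0 \o x = w \o @rev_ord d by apply/funext => j; apply: HU0.
(* [U0] sends the eigenvector for [kap (rev_ord i)] to [w i], and [Q (w i) = del i *: v i]. So for
   [U0] the operator is already diagonal in [v], pairing large [kap] with small [del]. *)
pose g i := kap (rev_ord i) * del i ^+ 2.
have g_gt0 i : 0 < g i by rewrite mulr_gt0// exprn_gt0.
have S0E : frame_op dot (canonical_dual dot V W (U0 \o F)) = diag_op dot v g.
  have U0xW : lspan (U0 \o x) = W.
    rewrite U0x -wWs; apply/seteqP; split; apply: lspan_le => i.
      exact: lspan_gen.
    by rewrite -(rev_ordK i); apply: (lspan_gen (w \o @rev_ord d)).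
  have [_ ->] := dualE _ U0unitary U0xW; rewrite U0x; apply/funext => y.
  rewrite /diag_op (reindex_inj rev_ord_inj); apply: eq_bigr => i _ /=.
  rewrite rev_ordK /Q Qw -[(cos (theta i))^-1]/(del i) dotZr conj_Creal ?complex_real//.
  by rewrite scalerA; congr (_ *: _); rewrite /g rmorphM rmorphXn /=; ring.
have [Ux_on SE] := dualE _ Uunitary Ux.
(* Row [j] holds the coordinates of [U (x j)] in [w]; applying [Q] multiplies column [l] by [del l]
   and replaces [w] by [v]. *)
pose u := \matrix_(j, l) dot (U (x j)) (w l).
have uE : comb u w = U \o x.
  apply/funext => j; rewrite [RHS](orthonormal_expand w_on).
    by apply: eq_bigr => l _; rewrite mxE.
  by rewrite wWs -Ux; apply: lspan_gen.
have uU : u \is unitarymx by apply: (unitary_orthonormal (dot := dot) w_on); rewrite uE.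
have QUx : Q \o (U \o x) = comb (u *m diagR del) v.
  apply/funext => j; rewrite -uE /= /comb /Q (oblique_proj_sum VW eV).
  apply: eq_bigr => l _; rewrite Qw scalerA mul_mx_diag !mxE.
  by rewrite mulrC.
rewrite QUx in SE.
have [z [rho [z_on rho_gt0 SrhoE le_prod]]] :=
  diag_op_spectral v_on uU kap_nondec del_nondec kap_gt0 del_gt0.
rewrite {}SrhoE in SE.
have sub := lam_log_submajorized v_on z_on g_gt0 rho_gt0 le_prod.
have lam0_gt0 := lam_gt0 v_on g_gt0; have lam_gt0 := lam_gt0 z_on rho_gt0.
have lam_mono (S : H -> H) i j : (i <= j < d)%N -> lam S j <= lam S i.
  by move=> /andP[ij _]; apply: lam_noninc.
rewrite /optimal_dual !S0E !SE; split.
  rewrite !optrace_diag_op// lecR -(big_lam v_on g_gt0 _ id) -(big_lam z_on rho_gt0 _ id) /=.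
  rewrite -subr_ge0 -sumrB.
  (* The trace inequality is the case of constant weights. *)
  have := log_submajorized_sum_ge0 (q := fun=> 1) lam0_gt0 lam_gt0 (lam_mono _) sub.
  move=> /(_ (fun _ _ => ler01) (fun _ _ => lexx _)).
  by under eq_bigr do rewrite mul1r.
move=> t G G0 _ [[G_dual _] [c [_ c_sum GE]]] [[G0_dual _] [c0 [c0_ge c0_sum G0E]]].
move=> h h_convex; rewrite /convex_potential.
rewrite (lspan_oblique_dual VW eV G0_dual) (lspan_oblique_dual VW eV G_dual).
rewrite (dimv_eq dimV).
under eq_bigr do rewrite G0E ltn_ord.
under [leRHS]eq_bigr do rewrite GE ltn_ord.
apply: convex_water_filling => //; first exact: lam_mono.
(* Both filled spectra have sum [t]. *)
by rewrite !big_split /= c_sum c0_sum !subrKC.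
Qed.
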